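(* Let $K>0$, and let $g$ be a probability density on $\mathbb{R}$ that is even and unimodal about its mean value $\Omega\in\mathbb{R}$; put $\tilde g(\omega):=g(\omega+\Omega)$. Let $u:\mathbb{R}\to\mathbb{R}$ be bounded and continuous. Let $\rho_*$ be a steady state solution (in the normalized form specified in the context) of the Kuramoto system without input with frequency density $\tilde g$, and let $c_n\in\mathbb{R}$, $n\in\mathbb{Z}$, be its $n$-th order parameters. For $\alpha\in\mathbb{R}$ set $$r_n(\alpha u;t)=c_n\,e^{in\left(\Omega t+\alpha\int_0^tu(s)\,ds\right)},\qquad n\in\mathbb{Z}.$$ If $c_n\neq0$ for every $n\in\mathbb{Z}$ and $\Omega\ne0$, then for all $\alpha$ with $|\alpha|$ sufficiently small there is $T=T(\alpha)>0$ with $T(\alpha)=2\pi/|\Omega|+O(\alpha)$ as $\alpha\to0$ such that $\{r_n(\alpha u;t)\}_{n\in\mathbb{Z}}$ is a complete basis of $L^2(0,T)$.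
   Context: Even and unimodal about $\Omega$: $g(\Omega+\omega)=g(\Omega-\omega)$ for all $\omega\in\mathbb{R}$; $g(\omega_1)>g(\omega_2)$ for $\Omega\le\omega_1<\omega_2$; and $g(\omega_1)<g(\omega_2)$ for $\omega_1<\omega_2\le\Omega$. Kuramoto system without input with frequency density $\tilde g$: $\rho(\theta,\omega,t)$ is, for each $\omega\in\mathbb{R}$ and $t$, a probability density (possibly a measure) in $\theta\in\mathbb{R}/2\pi\mathbb{Z}$ with $\partial_t\rho+\partial_\theta(\rho v)=0$, $v=\omega+K|r|\sin(\psi-\theta)$, $r=|r|e^{i\psi}:=\int_{\mathbb{R}}\int_0^{2\pi}e^{i\theta}\rho\,\tilde g(\omega)\,d\theta\,d\omega$. A steady state solution is a time-independent solution of the form $$\rho_*(\theta,\omega)=\begin{cases}\delta\bigl(\theta-\arcsin\frac{\omega}{Kr_*}\bigr),&|\omega|<Kr_*,\\[4pt]\dfrac{1}{2\pi}\dfrac{\sqrt{\omega^2-K^2r_*^2}}{|\omega-Kr_*\sin\theta|},&|\omega|>Kr_*,\end{cases}$$ where $\delta$ is the Dirac delta and $r_*\ge0$ is the first order parameter of $\rho_*$. Its $n$-th order parameter is $c_n:=\int_{\mathbb{R}}\int_0^{2\pi}e^{in\theta}\rho_*(\theta,\omega)\tilde g(\omega)\,d\theta\,d\omega$, which is real. Here $L^2(0,T)$ is the space of complex-valued square-integrable functions. A family $\{f_n\}_{n\in\mathbb{Z}}$ is a complete basis of $L^2(0,T)$ if its linear span is dense and each $f\in L^2(0,T)$ has a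 unique expansion $f=\lim_{M\to\infty}\sum_{n=-M}^{M}w_nf_n$ in $L^2(0,T)$ with $w_n\in\mathbb{C}$. *)

(* Defs.v *)
From HB Require Import structures.
From mathcomp Require Import all_boot all_order all_algebra.
From mathcomp Require Import complex.
From mathcomp Require Import all_classical all_reals all_analysis.

Set Implicit Arguments.
Unset Strict Implicit.
Unset Printing Implicit Defensive.

Import Order.TTheory GRing.Theory Num.Theory.
Import numFieldNormedType.Exports.
Import ComplexField.Normc.

Local Open Scope classical_set_scope.
Local Open Scope ring_scope.
Local Open Scope complex_scope.

Section Densities.
Context {R : realType}.
Implicit Types (g : R -> R) (Omega : R).

Definition probability_density g : Prop :=
  [/\ measurable_fun setT g, forall x, 0 <= g x
    & (\int[lebesgue_measure]_x (g x)%:E = 1)%E].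

(* The mean is taken as a principal value: it agrees with the usual mean when
   the latter exists, and heavy-tailed densities (e.g. Lorentzian) have one. *)
Definition has_mean_value g Omega : Prop :=
  (\int[lebesgue_measure]_(x in `[- M, M]) (x * g x)) @[M --> +oo] --> Omega.

Definition even_about Omega g : Prop :=
  forall w, g (Omega + w) = g (Omega - w).

Definition unimodal_about Omega g : Prop :=
  (forall w1 w2, Omega <= w1 -> w1 < w2 -> g w1 > g w2) /\
  (forall w1 w2, w1 < w2 -> w2 <= Omega -> g w1 < g w2).

End Densities.

Section Complex_valued.
Context {R : realType}.

Definition expi (x : R) : R[i] := cos x +i* sin x.

Definition cintegral d (X : measurableType d) (mu : {measure set X -> \bar R})
    (D : set X) (f : X -> R[i]) : R[i] :=
  (\int[mu]_(x in D) complex.Re (f x)) +i* (\int[mu]_(x in D) complex.Im (f x)).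

End Complex_valued.

Section Kuramoto.
Context {R : realType}.
Implicit Types (K r : R) (g : R -> R).
Implicit Types rho : R.-pker (measurableTypeR R) ~> (measurableTypeR R).

(* Fundamental domain of R / 2 pi Z.  A probability measure on the circle is
   represented by a probability measure on R carried by this domain, which
   contains the range of arcsin. *)
Definition circle : set (measurableTypeR R) := `[- pi, pi[%classic.

Definition order_parameter g rho (n : int) : R[i] :=
  cintegral lebesgue_measure setT (fun w : measurableTypeR R =>
    cintegral (rho w) circle (fun th => expi (n%:~R * th)) * (g w)%:C).

Definition test_function (phi : R -> R) : Prop :=
  [/\ forall th, phi (th + 2 * pi) = phi th,
      forall th, derivable phi th 1
    & continuous (derive1 phi)].

(* Measure-valued solutions: for each frequency w, the continuity equation
   d_t rho + d_theta (rho v) = 0 holds weakly in theta.  Here r t is the first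
   order parameter at time t, and psi its argument (any one if r t = 0). *)
Definition kuramoto_solution K g
    (rho : R -> R.-pker (measurableTypeR R) ~> (measurableTypeR R)) : Prop :=
  (forall t w, rho t w circle = 1%E) /\
  forall t, let r := order_parameter g (rho t) 1 in
  exists psi : R, r = (normc r)%:C * expi psi /\
  forall w phi, test_function phi ->
    is_derive t 1
      (fun s => \int[rho s w]_(th in circle) phi th)
      (\int[rho t w]_(th in circle)
         (derive1 phi th * (w + K * normc r * sin (psi - th)))).

(* No form is prescribed at the two frequencies |w| = K r. *)
Definition steady_form K r rho : Prop :=
  (forall w, `|w| < K * r -> forall A, measurable A ->
     rho w A = \d_(asin (w / (K * r))) A) /\
  (forall w, K * r < `|w| -> forall A, measurable A ->
     rho w A = (\int[lebesgue_measure]_(th in A `&` circle)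
       ((2 * pi)^-1 * (Num.sqrt (w ^+ 2 - K ^+ 2 * r ^+ 2)
                        / `|w - K * r * sin th|))%:E)%E).

Definition steady_state K g r rho : Prop :=
  [/\ 0 <= r, r%:C = order_parameter g rho 1,
      steady_form K r rho & kuramoto_solution K g (fun=> rho)].

(* Oriented integral from 0 to t: for t < 0 the first domain is empty, for
   t > 0 the second one is. *)
Definition primitive0 (u : R -> R) (t : R) : R :=
  \int[lebesgue_measure]_(s in `[0, t]) u s
  - \int[lebesgue_measure]_(s in `[t, 0]) u s.

Definition driven_order_parameter (Omega : R) (c : int -> R[i]) (alpha : R)
    (u : R -> R) (n : int) (t : R) : R[i] :=
  c n * expi (n%:~R * (Omega * t + alpha * primitive0 u t)).

End Kuramoto.

Section L2.
Context {R : realType}.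
Implicit Types (T : R) (f : R -> R[i]).

Definition L2norm T f : \bar R :=
  'N[lebesgue_measure]_2%:E[(fun t => (normc (f t))%:E) \_ `]0, T[].

Definition in_L2 T f : Prop :=
  [/\ measurable_fun `]0, T[ (fun t => complex.Re (f t)),
      measurable_fun `]0, T[ (fun t => complex.Im (f t))
    & (L2norm T f < +oo)%E].

Definition sym_partial_sum (w : int -> R[i]) (e : int -> R -> R[i]) (M : nat)
    (t : R) : R[i] :=
  \sum_(k < (2 * M).+1) w (k%:Z - M%:Z) * e (k%:Z - M%:Z) t.

Definition L2_expansion T (e : int -> R -> R[i]) f (w : int -> R[i]) : Prop :=
  L2norm T (fun t => f t - sym_partial_sum w e M t) @[M --> \oo] --> 0%E.

Definition complete_basis T (e : int -> R -> R[i]) : Prop :=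
  [/\ forall n, in_L2 T (e n),
      forall f, in_L2 T f -> forall eps : R, 0 < eps ->
        exists (s : seq int) (w : int -> R[i]),
          (L2norm T (fun t => (f t - \sum_(n <- s) w n * e n t)%R) < eps%:E)%E
    & forall f, in_L2 T f -> exists! w : int -> R[i], L2_expansion T e f w].

End L2.

(* Main.v *)
(* Write theta t = Omega t + alpha \int_0^t u and let sg be the sign of Omega.
   For small alpha, sg * theta' lies between |Omega| / 2 and 2 |Omega|, so
   sg * theta grows from 0 to 2 pi on an interval [0, T] with
   |T - 2 pi / |Omega|| <= C |alpha|.  The functions e^{i n theta} are
   orthonormal on (0, T) for the weight sg * theta' / (2 pi): the integrand
   e^{i (n - k) theta} theta' is an exact derivative.  The weighted norm is
   equivalent to the L^2 norm, so the symmetric Fourier sums are best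
   approximations, and everything reduces to the density of the trigonometric
   polynomials in theta.  If p is such a polynomial with values in [0, 1], then
   (1 - p^n)^(n 2^n) tends boundedly to the indicator of p < 1 / 2; suitable
   p = a + b cos (sg * theta - y) give the indicators of the intervals (0, s),
   hence by Dynkin's theorem those of all measurable sets, hence all of L^2.
   The nonzero factors c_n only rescale the coefficients. *)

Require Import Defs.
From mathcomp Require Import all_boot all_order all_algebra.
From mathcomp Require Import complex.
From mathcomp Require Import all_classical all_reals all_analysis.
From mathcomp Require Import measurable_realfun ring lra zify.
Import Order.TTheory GRing.Theory Num.Theory.
Import numFieldNormedType.Exports ComplexField.Normc.
Local Open Scope classical_set_scope.
Local Open Scope ring_scope.

Set Implicit Arguments.
Unset Strict Implicit.
Unset Printing Implicit Defensive.

Local Open Scope complex_scope.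

(** * L^2 approximation of real-valued functions by a set of functions *)

Section L2_closure.
Context d (X : measurableType d) (R : realType).
Variables (mu : {measure set X -> \bar R}) (D : set X) (mD : measurable D).
Implicit Types (f g h p q : X -> R) (A : set (X -> R)).

Definition sqdist f g : \bar R := (\int[mu]_(x in D) ((f x - g x) ^+ 2)%:E)%E.

(** The squared distance lives in [\bar R], hence makes sense for all measurable functions.
    Approximants must be measurable because [A] is an arbitrary set of functions. *)
Definition L2_closure A f := measurable_fun D f /\
  forall eps : R, 0 < eps ->
    exists2 p, A p /\ measurable_fun D p & (sqdist f p < eps%:E)%E.

Lemma measurable_sqdiff f g : measurable_fun D f -> measurable_fun D g ->
  measurable_fun D (EFin \o (fun x => (f x - g x) ^+ 2 : R)).
Proof.
by move=> mf mg; apply/measurable_EFinP; apply: measurable_funX; exact: measurable_funB.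
Qed.

(** Pointwise, (k a + l b)^2 <= 2 k^2 a^2 + 2 l^2 b^2: the difference of the two sides is (k a - l
    b)^2. *)
Lemma sqdist_comb (k l : R) f g p q : measurable_fun D f ->
  measurable_fun D g -> measurable_fun D p -> measurable_fun D q ->
  (sqdist (fun x => k * f x + l * g x)%R (fun x => k * p x + l * q x)%R <=
   (2 * k ^+ 2)%R%:E * sqdist f p + (2 * l ^+ 2)%R%:E * sqdist g q)%E.
Proof.
move=> mf mg mp mq.
have ge0 (m : R) : 0 <= 2 * m ^+ 2 by rewrite mulr_ge0// sqr_ge0.
have sq0 (h h' : X -> R) x : D x -> (0 <= ((h x - h' x) ^+ 2)%:E)%E.
  by rewrite lee_fin sqr_ge0.
have Z (m : R) h h' : measurable_fun D h -> measurable_fun D h' ->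
    (\int[mu]_(x in D) (2 * m ^+ 2 * (h x - h' x) ^+ 2)%:E =
     (2 * m ^+ 2)%R%:E * sqdist h h')%E.
  move=> mh mh'; have m0 : (0 <= (2 * m ^+ 2)%R%:E)%E by rewrite lee_fin.
  by rewrite -(ge0_integralZl mu mD (measurable_sqdiff mh mh') (sq0 _ _) m0).
have mZ (m : R) h h' : measurable_fun D h -> measurable_fun D h' ->
    measurable_fun D (fun x => (2 * m ^+ 2 * (h x - h' x) ^+ 2)%:E).
  move=> mh mh'; apply/measurable_EFinP; apply: measurable_funM => //.
  by apply: measurable_funX; exact: measurable_funB.
have Z0 (m : R) (h h' : X -> R) x :
    D x -> (0 <= (2 * m ^+ 2 * (h x - h' x) ^+ 2)%:E)%E.
  by move=> _; rewrite lee_fin mulr_ge0// sqr_ge0.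
rewrite -!Z//.
rewrite -(ge0_integralD mu mD (Z0 _ _ _) (mZ _ _ _ mf mp) (Z0 _ _ _) (mZ _ _ _ mg mq)).
apply: ge0_le_integral => //.
- exact: sq0.
- by apply: measurable_sqdiff; apply: measurable_funD; apply: measurable_funM.
- by apply: emeasurable_funD; exact: mZ.
move=> x _; rewrite -EFinD lee_fin -subr_ge0.
set a := f x - p x; set b := g x - q x.
rewrite (_ : _ - _ = (k * a - l * b) ^+ 2) ?sqr_ge0//; rewrite /a /b; ring.
Qed.

Lemma L2_closure_comb A (k l : R) f g :
  (forall p q, A p -> A q -> A (fun x => k * p x + l * q x)) ->
  L2_closure A f -> L2_closure A g ->
  L2_closure A (fun x => k * f x + l * g x).
Proof.
move=> AA [mf Af] [mg Ag]; split.
  by apply: measurable_funD; apply: measurable_funM.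
move=> eps eps0.
(* The [+ 1] keeps the denominator positive when the coefficient [m] is 0. *)
have e0 (m : R) : 0 < eps / 2 / (2 * m ^+ 2 + 1).
  by rewrite divr_gt0 ?divr_gt0// ltr_wpDl// mulr_ge0// sqr_ge0.
have [p [Ap mp] fp] := Af _ (e0 k); have [q [Aq mq] gq] := Ag _ (e0 l).
exists (fun x => k * p x + l * q x).
  by split; [exact: AA|apply: measurable_funD; apply: measurable_funM].
apply: (le_lt_trans (sqdist_comb k l mf mg mp mq)).
have H (m : R) s : (s < (eps / 2 / (2 * m ^+ 2 + 1))%:E)%E -> (0 <= s)%E ->
    ((2 * m ^+ 2)%:E * s < (eps / 2)%:E)%E.
  case: s => [s| |]//; rewrite lte_fin lee_fin -EFinM lte_fin => sm s0.
  have m0 : 0 < 2 * m ^+ 2 + 1 by rewrite ltr_wpDl// mulr_ge0// sqr_ge0.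
  move: sm; rewrite ltr_pdivlMr//; apply: le_lt_trans; nra.
rewrite [eps in ltRHS]splitr EFinD; apply: lteD; apply: H => //;
  by apply: integral_ge0 => x _; rewrite lee_fin sqr_ge0.
Qed.

(** f - g is (f + h) - (h + g), so this is [sqdist_comb] with both coefficients 1; the factors 2 are
    the price of squared distances. *)
Lemma sqdist_triangle f g h : measurable_fun D f ->
  measurable_fun D g -> measurable_fun D h ->
  (sqdist f g <= 2%:E * sqdist f h + 2%:E * sqdist h g)%E.
Proof.
move=> mf mg mh.
have := sqdist_comb 1 1 mf mh mh mg.
rewrite expr1n mulr1; apply: le_trans.
rewrite le_eqVlt; apply/orP; left; apply/eqP/eq_integral => x _ /=.
by congr (_ %:E); ring.
Qed.

(** Idempotence of the closure: it allows limit processes to be iterated. *)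
Lemma L2_closure_id A f : measurable_fun D f ->
  (forall eps : R, 0 < eps ->
     exists2 g, L2_closure A g & (sqdist f g < eps%:E)%E) ->
  L2_closure A f.
Proof.
move=> mf fA; split=> // eps eps0.
have e0 : 0 < eps / 4 by rewrite divr_gt0.
have [g [mg Ag] fg] := fA _ e0.
have [p [Ap mp] gp] := Ag _ e0.
exists p => //; apply: (le_lt_trans (sqdist_triangle mf mp mg)).
have -> : eps = 2 * (eps / 4) + 2 * (eps / 4) by field.
by rewrite [in ltRHS]EFinD; apply: lteD; rewrite [in ltRHS]EFinM lte_pmul2l.
Qed.

(** Dominated convergence, applied to the squared errors with majorant [G]. *)
Lemma L2_closure_lim A (f_ : nat -> X -> R) f (G : X -> R) :
  measurable_fun D f ->
  (forall n, L2_closure A (f_ n)) ->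
  (forall x, D x -> f_ ^~ x @ \oo --> f x) ->
  mu.-integrable D (EFin \o G) ->
  (forall n x, D x -> (f x - f_ n x) ^+ 2 <= G x) ->
  L2_closure A f.
Proof.
move=> mf Af ff iG fG; apply: L2_closure_id => // eps eps0.
have mff n : measurable_fun D (EFin \o (fun x => (f x - f_ n x) ^+ 2 : R)).
  by apply: measurable_sqdiff => //; case: (Af n).
have f0 x : D x -> ((f x - f_ n x) ^+ 2)%:E @[n --> \oo] --> (0 : R)%:E.
  move=> Dx; apply: cvg_EFin; first by near=> n.
  have <- : (f x - f x) ^+ 2 = 0 by rewrite subrr expr0n.
  have ffx := ff x Dx.
  have H : f x - f_ n x @[n --> \oo] --> f x - f x.
    by apply: (@cvgB _ R^o); [exact: cvg_cst|exact: ffx].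
  by rewrite expr2; exact: (cvgM H H).
have a0 n x : D x -> (`|((f x - f_ n x) ^+ 2)%:E| <= (G x)%:E)%E.
  by move=> Dx; rewrite gee0_abs lee_fin ?sqr_ge0// fG.
have Gfin x : D x -> (G x)%:E \is a fin_num by [].
have H := dominated_cvg mD mff f0 Gfin iG a0.
have [N _ /(_ N (leqnn N)) /= fN] : \forall n \near \oo, (sqdist f (f_ n) < eps%:E)%E.
  apply: (H [set y | (y < eps%:E)%E]); rewrite integral0.
  by apply: open_nbhs_nbhs; split; [exact: open_ereal_lt_ereal|rewrite /= lte_fin].
by exists (f_ N).
Unshelve. all: by end_near. Qed.

End L2_closure.

(** * From indicators of a generating pi-system to all of L^2 *)

Section L2_density.
Import HBSimple HBNNSimple.
Context d (X : measurableType d) (R : realType).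
Variables (mu : {measure set X -> \bar R}) (D : set X) (mD : measurable D).
Hypothesis muD : (mu D < +oo)%E.
Variable A : set (X -> R).
Hypothesis A_lin : forall (k l : R) p q, A p -> A q ->
  A (fun x => k * p x + l * q x).
Hypothesis A_cst1 : A (cst 1).
Implicit Types (f g : X -> R) (S : set X).

Lemma L2_closure_lin (k l : R) f g : L2_closure mu D A f ->
  L2_closure mu D A g -> L2_closure mu D A (fun x => k * f x + l * g x).
Proof. by apply: L2_closure_comb => // p q; exact: A_lin. Qed.

Lemma L2_closure_mem f : A f -> measurable_fun D f -> L2_closure mu D A f.
Proof.
move=> Af mf; split=> // eps eps0; exists f => //.
rewrite /sqdist; under eq_integral do rewrite subrr expr0n/=.
by rewrite integral0 lte_fin.
Qed.

Lemma L2_closure_cst (k : R) : L2_closure mu D A (cst k).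
Proof.
have cl1 : L2_closure mu D A (cst 1) by exact: L2_closure_mem.
have := L2_closure_lin k 0 cl1 cl1.
by congr L2_closure; apply/funext => x /=; rewrite mulr1 mul0r addr0.
Qed.

Lemma L2_closure_sum (I : Type) (s : seq I) (f : I -> X -> R) :
  (forall i, L2_closure mu D A (f i)) ->
  L2_closure mu D A (fun x => \sum_(i <- s) f i x).
Proof.
move=> Af; elim: s => [|i s IH].
  have := L2_closure_cst 0.
  by congr L2_closure; apply/funext => x /=; rewrite big_nil.
have := L2_closure_lin 1 1 (Af i) IH.
by congr L2_closure; apply/funext => x /=; rewrite big_cons !mul1r.
Qed.

(** Dynkin's theorem: the sets whose indicator lies in the closure are stable under complement by
    linearity, and under disjoint unions by dominated convergence with majorant 1, integrable
    because [mu D] is finite. *)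
Lemma L2_closure_indic (G : set (set X)) :
  @measurable _ X = <<s G >> -> setI_closed G ->
  (forall S, G S -> L2_closure mu D A \1_S) ->
  forall S, measurable S -> L2_closure mu D A \1_S.
Proof.
move=> GE GI AG S; rewrite GE; move: S.
apply: (dynkin_induction (P := fun S => L2_closure mu D A \1_S) GE GI).
- by rewrite indicT; exact: L2_closure_cst.
- exact: AG.
- move=> S mS AS; have := L2_closure_lin 1 (-1) (L2_closure_cst 1) AS.
  congr L2_closure; apply/funext => x /=; rewrite indicC indicE mul1r mulN1r.
  by case: (x \in S); rewrite /= ?subrr ?subr0.
- move=> F mF tF AF.
  pose f_ n x := \sum_(i < n) (\1_(F i) x : R).
  (* By disjointness a point of [F k] only meets the term of index k, which the sum over i < n
     contains exactly when k < n. *)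
  have fF n k x : F k x -> f_ n x = (k < n)%N%:R.
    move=> Fkx.
    have FE i : \1_(F i) x = (i == k)%:R :> R.
      rewrite indicE; have [->|ik] := eqVneq i k; first by rewrite mem_set.
      rewrite memNset// => Fix; move/trivIsetP : tF => /(_ i k I I ik).
      by apply/eqP/set0P; exists x.
    rewrite /f_; under eq_bigr do rewrite FE.
    case: ltnP => kn.
      rewrite (bigD1 (Ordinal kn))//= eqxx big1 ?addr0// => i.
      by rewrite -val_eqE /= => /negbTE ->.
    rewrite big1// => i _; rewrite ltn_eqF//.
    by rewrite (leq_trans _ kn).
  have fN n x : ~ (\bigcup_k F k) x -> f_ n x = 0.
    move=> nFx; rewrite /f_ big1// => i _; rewrite indicE memNset// => Fx.
    by apply: nFx; exists i.
  apply: (@L2_closure_lim _ _ _ _ _ mD _ f_ _ (cst 1)).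
  + by apply: measurable_indic; exact: bigcup_measurable.
  + by move=> n; exact: L2_closure_sum.
  + move=> x _; apply: cvg_near_cst.
    have [[k _ Fk]|nF] := pselect ((\bigcup_k F k) x).
      near=> n; rewrite (fF _ k)// indicE mem_set; last by exists k.
      by rewrite (_ : (k < n)%N)//; near: n; exact: nbhs_infty_gt.
    by near=> n; rewrite fN// indicE memNset.
  + apply: measurable_bounded_integrable => //.
    by exists 1; split => // r r1 x _; rewrite /= normr1 ltW.
  + move=> n x _; have [[k _ Fk]|nF] := pselect ((\bigcup_k F k) x).
      rewrite (fF _ k)// indicE mem_set; last by exists k.
      by case: ltnP => _ /=; rewrite ?subrr ?subr0 ?expr0n ?expr1n.
    by rewrite fN// indicE memNset// subr0 expr0n.
Unshelve. all: by end_near. Qed.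

(** For f >= 0, simple functions 0 <= f_n <= f converge to f, and (f - f_n)^2 <= f^2 supplies the
    integrable majorant. *)
Lemma L2_closure_sqr_integrable (G : set (set X)) f :
  @measurable _ X = <<s G >> -> setI_closed G ->
  (forall S, G S -> L2_closure mu D A \1_S) ->
  measurable_fun D f -> mu.-integrable D (EFin \o (fun x => f x ^+ 2 : R)) ->
  L2_closure mu D A f.
Proof.
move=> GE GI GA.
(* The positive and negative parts have squares at most f^2, so the nonnegative case applies to
   both. *)
wlog f0 : f / forall x, 0 <= f x => [wlg mf if2|].
  have -> : f = (fun x => 1 * f^\+ x + (-1) * f^\- x).
    by apply/funext => x; rewrite mul1r mulN1r -[in LHS](funrposBneg f).
  apply: L2_closure_lin; apply: wlg => //.
  - exact: measurable_funrpos.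
  - apply: (le_integrable mD _ _ if2).
    + apply/measurable_EFinP; apply: measurable_funX; exact: measurable_funrpos.
    + move=> x Dx; rewrite lee_fin !ger0_norm ?sqr_ge0// /funrpos.
      by have [fx|fx] := leP (f x) 0; rewrite ?expr0n /= ?sqr_ge0.
  - exact: measurable_funrneg.
  - apply: (le_integrable mD _ _ if2).
    + apply/measurable_EFinP; apply: measurable_funX; exact: measurable_funrneg.
    + move=> x Dx; rewrite lee_fin !ger0_norm ?sqr_ge0// /funrneg /=.
      by have [fx|fx] := leP (- f x) 0; rewrite ?sqrrN ?expr0n /= ?sqr_ge0.
move=> mf if2.
have mEf : measurable_fun D (EFin \o f) by exact/measurable_EFinP.
pose f_ := nnsfun_approx mD mEf.
have f0' x : D x -> (0 <= (EFin \o f) x)%E by move=> _; rewrite lee_fin.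
have lim_f := @L2_closure_lim _ _ _ mu D mD A (fun n => f_ n : X -> R) f
  (fun x => f x ^+ 2) mf.
apply: lim_f => //.
- move=> n.
  have -> : (f_ n : X -> R) = (fun x =>
      \sum_(y <- finmap.enum_fset (fset_set (range (f_ n))))
        y * \1_(f_ n @^-1` [set y]) x).
    by apply/funext => x; rewrite fimfunE fsbig_finite.
  apply: L2_closure_sum => y.
  pose ind : X -> R := \1_(f_ n @^-1` [set y]).
  have := @L2_closure_lin y 0 ind ind.
  have -> : (fun x => y * ind x + 0 * ind x) = (fun x => y * ind x).
    by apply/funext => x; rewrite mul0r addr0.
  by apply; apply: (L2_closure_indic GE GI GA).
- by move=> x Dx; have /fine_cvgP[] := cvg_nnsfun_approx mD mEf f0' Dx.
- move=> n x Dx.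
  have := le_approx n f0' Dx; rewrite -(nnsfun_approxE mD mEf) lee_fin /=.
  rewrite -/f_ => fn; have : 0 <= f_ n x by [].
  have := f0 x; nra.
Qed.
End L2_density.

(** * Powers that approximate a step function *)

Section power_approximation.
Context {R : realType}.
Implicit Types p x z : R.

(** 1 - p^n is (1 - p) times the geometric sum 1 + p + ... + p^(n-1), which has n terms, each at
    least p^n. *)
Lemma natr_expr_le p n : 0 <= p <= 1 -> n%:R * p ^+ n * (1 - p) <= 1 - p ^+ n.
Proof.
move=> /andP[p0 p1]; elim: n => [|n IH]; first by rewrite !mul0r expr0 subrr.
have pn0 : 0 <= p ^+ n by rewrite exprn_ge0.
have pn1 : p * p ^+ n <= 1 by rewrite -exprS exprn_ile1.
have := ler_wpM2l p0 IH.
have : 0 <= (1 - p) * (1 - p * p ^+ n) by rewrite mulr_ge0// subr_ge0.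
rewrite -natr1 exprS; lra.
Qed.

(** With w the square root of z, n z^n = (n w^n) w^n, where n w^n <= 1 / (1 - w) and w^n tends to
    0. *)
Lemma cvg_natr_expr z : 0 <= z < 1 -> n%:R * z ^+ n @[n --> \oo] --> (0 : R).
Proof.
move=> /andP[z0 z1]; set w := Num.sqrt z.
have w0 : 0 <= w by exact: sqrtr_ge0.
have wz : z = w ^+ 2 by rewrite sqr_sqrtr.
have w1 : w < 1 by rewrite -sqrtr1 ltr_sqrt.
have cw : (1 - w)^-1 * w ^+ n @[n --> \oo] --> (1 - w)^-1 * 0.
  by apply: cvgMl_tmp; apply: cvg_expr; rewrite ger0_norm.
rewrite mulr0 in cw; apply: (squeeze_cvgr _ (@cvg_cst _ _ _ _ _ ) cw).
near=> n; apply/andP; split; first by rewrite mulr_ge0// exprn_ge0.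
have : n%:R * w ^+ n * (1 - w) <= 1 - w ^+ n by apply: natr_expr_le; rewrite w0 ltW.
have wn0 : 0 <= w ^+ n by rewrite exprn_ge0.
move=> H; rewrite wz -exprM mulnC exprM expr2 mulrA ler_wpM2r//.
rewrite -[leRHS]mulr1 ler_pdivlMl ?subr_gt0//; lra.
Unshelve. all: by end_near. Qed.

(** Lower bound for the step: with x = p^n and exponent n 2^n the left side is 1 - n (2 p)^n, which
    tends to 1 for p < 1 / 2. *)
Lemma bernoulli_ge x n : 0 <= x <= 1 -> 1 - n%:R * x <= (1 - x) ^+ n.
Proof.
move=> /andP[x0 x1]; elim: n => [|n IH]; first by rewrite mul0r subr0 expr0.
have n0 : 0 <= n%:R :> R by [].
rewrite -natr1 exprS; nra.
Qed.

(** Upper bound for the step: for p >= 1 / 2 the same substitution gives at most 1 / (1 + n (2 p)^n)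
    <= 1 / (1 + n). The induction rests on (1 - x) (1 + (n + 1) x) <= 1 + n x. *)
Lemma bernoulli_le x n : 0 <= x <= 1 -> (1 - x) ^+ n * (1 + n%:R * x) <= 1.
Proof.
move=> /andP[x0 x1]; elim: n => [|n IH]; first by rewrite mul0r addr0 expr0 mulr1.
have n0 : 0 <= n%:R :> R by [].
have e0 : 0 <= (1 - x) ^+ n by rewrite exprn_ge0// subr_ge0.
apply: le_trans IH; rewrite exprSr -mulrA ler_wpM2l// -natr1.
have : 0 <= n%:R * x ^+ 2 by rewrite mulr_ge0// sqr_ge0.
by have := sqr_ge0 x; lra.
Qed.

(* The exponent [n * 2 ^ n] makes the limit [0], rather than [1 / e], at the
   threshold [p = 1 / 2]. *)
Lemma cvg_step p : 0 <= p <= 1 ->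
  (1 - p ^+ n) ^+ (n * 2 ^ n) @[n --> \oo] --> ((p < 2^-1)%R%:R : R).
Proof.
move=> /andP[p0 p1].
have pn n : 0 <= p ^+ n <= 1 by rewrite exprn_ge0// exprn_ile1.
have Dn n : (n * 2 ^ n)%:R * p ^+ n = n%:R * (2 * p) ^+ n.
  by rewrite natrM natrX -mulrA -exprMn.
case: ltP => p2.
  have c1 : 1 - n%:R * (2 * p) ^+ n @[n --> \oo] --> (1 : R).
    rewrite -[X in _ --> X]subr0; apply: cvgB; first exact: cvg_cst.
    apply: cvg_natr_expr; apply/andP; split; [lra|].
    by move: p2; rewrite -ltr_pdivlMl// mulr1.
  apply: (squeeze_cvgr _ c1 (@cvg_cst _ _ _ _ _)).
  near=> n; rewrite -Dn bernoulli_ge//=; have /andP[? ?] := pn n.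
  by rewrite exprn_ile1 ?subr_ge0// gerBl.
have c1 : (1 + n%:R)^-1 @[n --> \oo] --> (0 : R).
  have := @cvg_harmonic R; rewrite /harmonic; apply: cvg_trans.
  by apply: near_eq_cvg; near=> n; rewrite nat1r.
apply: (squeeze_cvgr _ (@cvg_cst _ _ _ _ _) c1).
near=> n; have /andP[? ?] := pn n.
rewrite exprn_ge0 ?subr_ge0//= -[leRHS]mul1r ler_pdivlMr; last by rewrite ltr_wpDr.
apply: le_trans (bernoulli_le (n * 2 ^ n) (pn n)); rewrite Dn.
apply: ler_wpM2l; first by rewrite exprn_ge0 ?subr_ge0.
rewrite lerD2l ler_peMr// exprn_ege1//.
by move: p2; rewrite -ler_pdivrMl// mulr1.
Unshelve. all: by end_near. Qed.

End power_approximation.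

(** * The exponential on the unit circle and trigonometric identities *)

Section circle_exponential.
Context {R : realType}.
Implicit Types x y : R.

Lemma expi0 : expi (0 : R) = 1.
Proof. by rewrite /expi cos0 sin0. Qed.

Lemma expiD x y : expi (x + y) = expi x * expi y.
Proof.
by rewrite /expi cosD sinD; simpc; congr (_ +i* _); ring.
Qed.

Lemma expi_conj x : conjc (expi x) = expi (- x).
Proof. by rewrite /expi cosN sinN. Qed.

Lemma expi_2pi_int (n : int) : expi (n%:~R * (2 * pi) : R) = 1.
Proof.
have nat_case k : expi (k%:R * (2 * pi) : R) = 1.
  elim: k => [|k IH]; first by rewrite mul0r expi0.
  by rewrite -natr1 mulrDl mul1r expiD IH mul1r /expi mulr_natl cos2pi sin2pi.
case: n => k; first exact: nat_case.
by rewrite NegzE mulrNz mulNr -expi_conj nat_case conjc1.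
Qed.

Lemma real_cosE x : (cos x)%:C = 2^-1 * expi x + 2^-1 * expi (- x).
Proof.
rewrite -mulrDr /expi cosN sinN; apply: (@mulfI _ 2) => //.
rewrite mulrA divff// mul1r mulr_natl mulr2n.
by apply/eqP; rewrite eq_complex /= ?subrr ?addr0 ?eqxx.
Qed.

Lemma normc_ge0 (z : R[i]) : 0 <= normc z.
Proof. by case: z => a b; exact: sqrtr_ge0. Qed.

Lemma normc_expi x : normc (expi x) = 1.
Proof. by rewrite /normc /expi cos2Dsin2 sqrtr1. Qed.

(** For 0 < x < 2 pi the factor sin (x / 2) is positive, so the sign of the difference locates x
    relative to 2 y. *)
Lemma cosB_sub_cos x y :
  cos (x - y) - cos y = 2 * sin (x / 2) * sin (y - x / 2).
Proof.
have cosBD a b : cos (a - b) - cos (a + b) = 2 * sin a * sin b :> R.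
  by rewrite cosB cosD; ring.
by rewrite -cosBD; congr (cos _ - cos _); field.
Qed.

Lemma sin_gt0E x : - pi < x < pi -> (0 < sin x) = (0 < x).
Proof.
move=> /andP[x1 x2]; have [x0|x0|<-] := ltgtP 0 x.
- by rewrite sin_gt0_pi// x0.
- apply/negbTE; rewrite -leNgt -oppr_ge0 -sinN ltW// sin_gt0_pi//.
  by rewrite oppr_gt0 x0 ltrNl.
- by rewrite sin0 ltxx.
Qed.

End circle_exponential.

(** * Trigonometric polynomials in the phase [theta] *)

Section trigonometric_polynomials.
Context {R : realType}.
Variable theta : R -> R.
Implicit Types (f g : R -> R[i]) (p q : R -> R).

Definition mode (n : int) (t : R) : R[i] := expi (n%:~R * theta t).

(** The complex span of the modes, as an inductive class of functions: no degree or coefficient list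
    is carried, and properties follow by induction on the construction. *)
Inductive trig_poly : (R -> R[i]) -> Prop :=
| trig_poly_mode n : trig_poly (mode n)
| trig_polyD f g : trig_poly f -> trig_poly g -> trig_poly (fun t => f t + g t)
| trig_polyZ a f : trig_poly f -> trig_poly (fun t => a * f t).

Definition real_trig_poly p := trig_poly (fun t => (p t)%:C).

Lemma mode0 t : mode 0 t = 1.
Proof. by rewrite /mode mul0r expi0. Qed.

Lemma modeD m n t : mode (m + n) t = mode m t * mode n t.
Proof. by rewrite /mode intrD mulrDl expiD. Qed.

Lemma mode_conj n t : conjc (mode n t) = mode (- n) t.
Proof. by rewrite /mode expi_conj mulrNz mulNr. Qed.

Lemma eq_trig_poly f g : f =1 g -> trig_poly f -> trig_poly g.
Proof. by move=> /funext ->. Qed.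

(** Double induction down to products of two modes, which are modes by [modeD]. Stability under
    products makes the powers of [cvg_step] available. *)
Lemma trig_polyM f g : trig_poly f -> trig_poly g ->
  trig_poly (fun t => f t * g t).
Proof.
move=> + tg; elim=> [n|f1 f2 _ t1 _ t2|a f1 _ t1].
- elim: tg => [m|g1 g2 _ t1 _ t2|a g1 _ t1].
  + by apply: (eq_trig_poly _ (trig_poly_mode (n + m))) => t; rewrite modeD.
  + by apply: (eq_trig_poly _ (trig_polyD t1 t2)) => t; rewrite mulrDr.
  + by apply: (eq_trig_poly _ (trig_polyZ a t1)) => t; rewrite mulrCA.
- by apply: (eq_trig_poly _ (trig_polyD t1 t2)) => t; rewrite mulrDl.
- by apply: (eq_trig_poly _ (trig_polyZ a t1)) => t; rewrite mulrA.
Qed.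

Lemma real_trig_poly_lin (k l : R) p q :
  real_trig_poly p -> real_trig_poly q ->
  real_trig_poly (fun t => k * p t + l * q t).
Proof.
move=> tp tq.
apply: (eq_trig_poly _ (trig_polyD (trig_polyZ k%:C tp) (trig_polyZ l%:C tq))).
by move=> t; rewrite rmorphD !rmorphM.
Qed.

Lemma real_trig_poly1 : real_trig_poly (cst 1).
Proof. by apply: (eq_trig_poly _ (trig_poly_mode 0)) => t; rewrite mode0. Qed.

Lemma real_trig_polyM p q : real_trig_poly p -> real_trig_poly q ->
  real_trig_poly (fun t => p t * q t).
Proof.
by move=> tp tq; apply: (eq_trig_poly _ (trig_polyM tp tq)) => t; rewrite rmorphM.
Qed.

Lemma real_trig_polyX p n : real_trig_poly p -> real_trig_poly (fun t => p t ^+ n).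
Proof.
move=> tp; elim: n => [|n IH]; first exact: real_trig_poly1.
by apply: (eq_trig_poly _ (real_trig_polyM tp IH)) => t; rewrite exprS.
Qed.

Lemma real_trig_poly_affine (k l : R) p : real_trig_poly p ->
  real_trig_poly (fun t => k + l * p t).
Proof.
move=> tp; apply: (eq_trig_poly _ (real_trig_poly_lin k l real_trig_poly1 tp)).
by move=> t; rewrite mulr1.
Qed.

Lemma real_trig_poly_cos (y : R) : real_trig_poly (fun t => cos (theta t - y)).
Proof.
apply: (eq_trig_poly _ (trig_polyD (trig_polyZ (2^-1 * expi (- y)) (trig_poly_mode 1))
  (trig_polyZ (2^-1 * expi y) (trig_poly_mode (-1))))) => t.
rewrite real_cosE opprB !expiD /mode mulN1r mul1r -!mulrA.
by congr (_ * _ + _ * _); rewrite mulrC.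
Qed.

Definition cmeasurable (D : set R) f :=
  measurable_fun D (fun t => complex.Re (f t)) /\
  measurable_fun D (fun t => complex.Im (f t)).

Lemma cmeasurableD D f g : cmeasurable D f -> cmeasurable D g ->
  cmeasurable D (fun t => f t + g t).
Proof.
move=> [f1 f2] [g1 g2]; split.
  have := measurable_funD f1 g1; congr measurable_fun; apply/funext => t /=.
  by case: (f t) (g t) => [a b] [c e].
have := measurable_funD f2 g2; congr measurable_fun; apply/funext => t /=.
by case: (f t) (g t) => [a b] [c e].
Qed.

Lemma cmeasurableM D f g : cmeasurable D f -> cmeasurable D g ->
  cmeasurable D (fun t => f t * g t).
Proof.
move=> [f1 f2] [g1 g2]; split.
  have := measurable_funB (measurable_funM f1 g1) (measurable_funM f2 g2).
  congr measurable_fun; apply/funext => t /=.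
  by case: (f t) (g t) => [a b] [c e].
have := measurable_funD (measurable_funM f1 g2) (measurable_funM f2 g1).
congr measurable_fun; apply/funext => t /=.
by case: (f t) (g t) => [a b] [c e].
Qed.

Lemma cmeasurable_cst D a : cmeasurable D (fun=> a).
Proof. by split; exact: measurable_cst. Qed.

Lemma trig_poly_measurable (D : set R) f : measurable_fun D theta ->
  trig_poly f -> cmeasurable D f.
Proof.
move=> mtheta; elim=> [n|f1 f2 _ ? _ ?|a f1 _ ?].
- split; rewrite /mode /expi /=.
  + apply: (measurableT_comp (continuous_measurable_fun (@continuous_cos R))).
    exact: measurable_funM.
  + apply: (measurableT_comp (continuous_measurable_fun (@continuous_sin R))).
    exact: measurable_funM.
- exact: cmeasurableD.
- by apply: cmeasurableM => //; exact: cmeasurable_cst.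
Qed.

End trigonometric_polynomials.

(** * Density of trigonometric polynomials in L^2(0, T) *)

Section trigonometric_density.
Context {R : realType}.
Notation mu := (@lebesgue_measure R).
Variables (theta : R -> R) (T sg : R).
Notation D := (`]0, T[%classic : set (measurableTypeR R)).
Hypothesis mtheta : measurable_fun D theta.
Hypothesis sg2 : sg ^+ 2 = 1.
Hypothesis theta_incr : forall s t, 0 < s -> s < t -> t < T ->
  sg * theta s < sg * theta t.
Hypothesis theta_range : forall t, 0 < t < T -> 0 < sg * theta t < 2 * pi.

Lemma lebesgue_measure_ooitv_lty : (mu D < +oo)%E.
Proof. by rewrite lebesgue_measure_itv/=; case: ifP => // _; rewrite ltry. Qed.

Lemma bounded_integrable_ooitv (p : R -> R) : measurable_fun D p ->
  (exists B, forall t, `|p t| <= B) -> mu.-integrable D (EFin \o p).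
Proof.
move=> mp [B pB].
apply: (measurable_bounded_integrable _ lebesgue_measure_ooitv_lty mp) => //.
exists B; split; first by rewrite num_real.
by move=> r Br t _; apply: le_trans (pB t) (ltW Br).
Qed.

Lemma real_trig_poly_measurable p : real_trig_poly theta p -> measurable_fun D p.
Proof. by move=> tp; have [] := trig_poly_measurable mtheta tp. Qed.

(** Let x = sg * theta t, a point of (0, 2 pi). The inequality says cos y < cos (x - y), that is 0 <
    sin (x / 2) sin (y - x / 2), hence x < 2 y = sg * theta s; monotonicity turns this into t <
    s. *)
Lemma ray_separation s t : 0 < s < T -> 0 < t < T ->
  let y := sg * theta s / 2 in
  (2^-1 + 4^-1 * cos y + (- 4^-1) * cos (theta t - sg * y) < 2^-1) = (t < s).
Proof.
move=> s0T t0T y.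
have [/andP[s0 sT] /andP[t0 tT]] := (s0T, t0T).
have /andP[hs0 hs2] := theta_range s0T; have /andP[ht0 ht2] := theta_range t0T.
(* As [sg] is 1 or -1 and cosine is even, the sign moves onto [theta t]. *)
have ccos : cos (theta t - sg * y) = cos (sg * theta t - y).
  have -> : sg * theta t - y = sg * (theta t - sg * y).
    by rewrite mulrBr mulrA -expr2 sg2 mul1r.
  have : sg ^+ 2 == 1 ^+ 2 by rewrite sg2 expr1n.
  rewrite eqf_sqr => /orP[/eqP->|/eqP->].
  - by rewrite !mul1r.
  - by rewrite !mulN1r cosN.
rewrite ccos.
set x := sg * theta t in ht0 ht2 *.
have sx : 0 < sin (x / 2).
  by rewrite sin_gt0_pi// divr_gt0//= ltr_pdivrMr// mulrC.
transitivity (0 < cos (x - y) - cos y); first by apply/idP/idP; lra.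
(* Both y and x / 2 lie in (0, pi), so their difference lies where sine has the sign of its
   argument. *)
rewrite cosB_sub_cos pmulr_rgt0 ?mulr_gt0// sin_gt0E; last first.
  by apply/andP; rewrite /y; split; lra.
have -> : (0 < y - x / 2) = (x < sg * theta s) by rewrite /y; apply/idP/idP; lra.
have [ts|st|ts] := ltgtP t s.
- by rewrite theta_incr.
- by apply/negbTE; rewrite -leNgt ltW// theta_incr.
- by rewrite /x ts ltxx.
Qed.

Lemma L2_closure_ray (s : R) :
  L2_closure mu D (real_trig_poly theta) (\1_`]-oo, s[ : measurableTypeR R -> R).
Proof.
have mD : measurable D by exact: measurable_itv.
have lin := @real_trig_poly_lin R theta.
have one : real_trig_poly theta (cst 1) by exact: real_trig_poly1.
(* Membership in the closure depends only on the values on [D]. *)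
have eqD (f g : measurableTypeR R -> R) : {in D, f =1 g} ->
    L2_closure mu D (real_trig_poly theta) f ->
    L2_closure mu D (real_trig_poly theta) g.
  move=> fg [mf Af]; split; first exact: eq_measurable_fun mf.
  move=> eps /Af[p Ap fp]; exists p => //; apply: le_lt_trans fp.
  by rewrite le_eqVlt; apply/orP; left; apply/eqP/eq_integral => x xD; rewrite fg.
(* On [D] the indicator is constantly 0 if s <= 0 and constantly 1 if T <= s. *)
have [s0|s0] := leP s 0.
  apply: (eqD (cst 0)); last exact: (L2_closure_cst mu mD lin one).
  move=> t; rewrite inE/= in_itv/= => /andP[t0 tT].
  by rewrite indicE memNset//= in_itv/= ltNge (ltW (le_lt_trans s0 t0)).
have [sT|sT] := leP T s.
  apply: (eqD (cst 1)); last exact: (L2_closure_cst mu mD lin one).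
  move=> t; rewrite inE/= in_itv/= => /andP[t0 tT].
  by rewrite indicE mem_set//= in_itv/= (lt_le_trans tT).
have s0T : 0 < s < T by rewrite s0.
pose y := sg * theta s / 2.
(* The coefficients 1 / 4 keep p within [0, 1]; on (0, T), p is below 1 / 2 exactly for t < s. *)
pose p t := 2^-1 + 4^-1 * cos y + (- 4^-1) * cos (theta t - sg * y).
have tp : real_trig_poly theta p.
  by apply: real_trig_poly_affine; exact: real_trig_poly_cos.
have p01 t : 0 <= p t <= 1.
  have := cos_le1 y; have := cos_geN1 y.
  have := cos_le1 (theta t - sg * y); have := cos_geN1 (theta t - sg * y).
  by rewrite /p => *; apply/andP; split; lra.
pose q n t := (1 + (-1) * p t ^+ n) ^+ (n * 2 ^ n).
have tq n : real_trig_poly theta (q n).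
  by apply: real_trig_polyX; apply: real_trig_poly_affine; exact: real_trig_polyX.
have q01 n t : 0 <= q n t <= 1.
  have /andP[p0 p1] := p01 t; rewrite /q mulN1r.
  by rewrite exprn_ge0 ?exprn_ile1 ?subr_ge0 ?exprn_ile1 ?gerBl ?exprn_ge0.
apply: (@L2_closure_lim _ _ _ mu D mD _ q _ (cst 1)).
- by apply: measurable_indic; exact: measurable_itv.
- move=> n; exact: (L2_closure_mem mu (tq n) (real_trig_poly_measurable (tq n))).
- move=> t; rewrite /= in_itv/= => t0T.
  have -> : \1_`]-oo, s[ t = ((p t < 2^-1)%R%:R : R).
    by rewrite /p ray_separation// indicE mem_setE in_itv.
  by rewrite /q; under eq_fun do rewrite mulN1r; exact: cvg_step.
- apply: bounded_integrable_ooitv; first exact: measurable_cst.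
  by exists 1 => t; rewrite normr1.
- move=> n t _; have /andP[q0 q1] := q01 n t.
  by rewrite indicE; case: (_ \in _); rewrite /=; nra.
Qed.

Lemma normc_sqr (z : R[i]) : normc z ^+ 2 = complex.Re z ^+ 2 + complex.Im z ^+ 2.
Proof. by case: z => a b; rewrite sqr_sqrtr// addr_ge0 ?sqr_ge0. Qed.

Lemma normc_sqr_measurable (E : set R) (f : R -> R[i]) : cmeasurable E f ->
  measurable_fun E (fun t => normc (f t) ^+ 2).
Proof.
move=> [m1 m2]; under eq_fun do rewrite normc_sqr.
by apply: measurable_funD; apply: measurable_funX.
Qed.

(** Real and imaginary parts are approximated separately, each within eps / 2, since their squared
    errors add up. The open rays form the generating pi-system. *)
Lemma trig_poly_dense (f : R -> R[i]) : cmeasurable D f ->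
  mu.-integrable D (EFin \o (fun t => normc (f t) ^+ 2 : R)) ->
  forall eps : R, 0 < eps -> exists2 p, trig_poly theta p &
    (\int[mu]_(t in D) (normc (f t - p t) ^+ 2)%:E < eps%:E)%E.
Proof.
move=> [mRe mIm] if2.
have mD : measurable D by exact: measurable_itv.
have lin := @real_trig_poly_lin R theta.
have one : real_trig_poly theta (cst 1) by exact: real_trig_poly1.
have muD := lebesgue_measure_ooitv_lty.
have GI : setI_closed (RGenInftyO.G (R := R)).
  move=> _ _ [x ->] [y ->]; exists (Num.min x y).
  apply/seteqP; split => t /=; rewrite !in_itv/= lt_min.
    by move=> [-> ->].
  by move=> /andP[].
have cl (h : R -> R) : measurable_fun D h -> (forall t, h t ^+ 2 <= normc (f t) ^+ 2) ->
    L2_closure mu D (real_trig_poly theta) h.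
  move=> mh hf; apply: (L2_closure_sqr_integrable mD muD lin one _ GI) => //.
  - exact: RGenInftyO.measurableE.
  - by move=> _ [s ->]; exact: L2_closure_ray.
  - apply: le_integrable if2 => //.
      by apply/measurable_EFinP; exact: measurable_funX.
    by move=> t _; rewrite lee_fin !ger0_norm ?sqr_ge0.
have Re_le t : complex.Re (f t) ^+ 2 <= normc (f t) ^+ 2.
  by rewrite normc_sqr lerDl sqr_ge0.
have Im_le t : complex.Im (f t) ^+ 2 <= normc (f t) ^+ 2.
  by rewrite normc_sqr lerDr sqr_ge0.
have [_ Re_cl] := cl _ mRe Re_le; have [_ Im_cl] := cl _ mIm Im_le.
move=> eps eps0; have e2 : 0 < eps / 2 by rewrite divr_gt0.
have [p [tp mp] fp] := Re_cl _ e2; have [q [tq mq] fq] := Im_cl _ e2.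
exists (fun t => (p t)%:C + 'i * (q t)%:C).
  by apply: trig_polyD => //; exact: trig_polyZ.
rewrite [eps]splitr EFinD; apply: le_lt_trans (lteD fp fq).
rewrite /sqdist -(ge0_integralD mu mD)//=.
- rewrite le_eqVlt; apply/orP; left; apply/eqP/eq_integral => t _ /=.
  rewrite -EFinD normc_sqr; case: (f t) => a b /=.
  by congr (_ + _)%:E; congr (_ ^+ 2); ring.
- by move=> t _; rewrite lee_fin sqr_ge0.
- by apply: measurable_sqdiff.
- by move=> t _; rewrite lee_fin sqr_ge0.
- by apply: measurable_sqdiff.
Qed.

End trigonometric_density.

(** * Integrals of complex-valued functions and square integrability *)

Section complex_integral.
Context {R : realType}.
Notation mu := (@lebesgue_measure R).
Variable D : set (measurableTypeR R).
Hypothesis mD : measurable D.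
Implicit Types (f g : R -> R[i]).

Lemma normc_conj (z : R[i]) : normc (conjc z) = normc z.
Proof. by case: z => a b; rewrite /normc /= sqrrN. Qed.

Lemma normc_real (x : R) : normc x%:C = `|x|.
Proof. by rewrite /normc /= expr0n addr0 sqrtr_sqr. Qed.

Lemma cmeasurable_conj f : cmeasurable D f -> cmeasurable D (fun t => conjc (f t)).
Proof.
move=> [f1 f2]; split.
  by move: f1; congr measurable_fun; apply/funext => t; case: (f t).
have := measurable_funM (@measurable_cst _ _ _ _ D (-1 : R)) f2.
by congr measurable_fun; apply/funext => t /=; case: (f t) => a b; rewrite mulN1r.
Qed.

Definition cintegrable f :=
  mu.-integrable D (EFin \o (fun t => complex.Re (f t))) /\
  mu.-integrable D (EFin \o (fun t => complex.Im (f t))).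

Lemma eq_cintegral f g : {in D, f =1 g} -> cintegral mu D f = cintegral mu D g.
Proof.
by move=> fg; congr (_ +i* _); apply: eq_Rintegral => t tD; rewrite fg.
Qed.

Lemma cintegralD f g : cintegrable f -> cintegrable g ->
  cintegral mu D (fun t => f t + g t) = cintegral mu D f + cintegral mu D g.
Proof.
move=> [f1 f2] [g1 g2]; rewrite /cintegral; simpc; rewrite -!RintegralD//.
by congr (_ +i* _); apply: eq_Rintegral => t _; case: (f t) (g t) => [? ?] [].
Qed.

Lemma cintegralZ a f : cintegrable f ->
  cintegral mu D (fun t => a * f t) = a * cintegral mu D f.
Proof.
case: a => a b [f1 f2]; rewrite /cintegral; simpc.
have ZZ (k : R) h : mu.-integrable D (EFin \o h) ->
    mu.-integrable D (EFin \o (fun t => k * h t)).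
  by move=> ih; have := integrableZl mD k ih.
rewrite -!RintegralZl// -RintegralB -?RintegralD//; try exact: ZZ.
by congr (_ +i* _); apply: eq_Rintegral => t _; case: (f t).
Qed.

Lemma normc_ge_Re_Im (z : R[i]) :
  `|complex.Re z| <= normc z /\ `|complex.Im z| <= normc z.
Proof.
by case: z => a b; split; rewrite -sqrtr_sqr ler_wsqrtr ?lerDl ?lerDr ?sqr_ge0.
Qed.

Lemma le_cintegrable f (G : R -> R) : cmeasurable D f ->
  mu.-integrable D (EFin \o G) -> (forall t, D t -> normc (f t) <= G t) ->
  cintegrable f.
Proof.
move=> [m1 m2] iG fG; split; apply: (le_integrable mD _ _ iG).
- exact/measurable_EFinP.
- move=> t Dt; rewrite lee_fin (le_trans _ (ler_norm _))//.
  by apply: le_trans (fG t Dt); have [] := normc_ge_Re_Im (f t).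
- exact/measurable_EFinP.
- move=> t Dt; rewrite lee_fin (le_trans _ (ler_norm _))//.
  by apply: le_trans (fG t Dt); have [] := normc_ge_Re_Im (f t).
Qed.

(** Working form of membership in L^2, through the integral of the square instead of a norm in
    [\bar R]; [in_L2P] shows that both agree on (0, T). *)
Definition sqr_integrable f := cmeasurable D f /\
  mu.-integrable D (EFin \o (fun t => normc (f t) ^+ 2 : R)).

Lemma sqr_integrableD f g : sqr_integrable f -> sqr_integrable g ->
  sqr_integrable (fun t => f t + g t).
Proof.
move=> [mf f2] [mg g2]; split; first exact: cmeasurableD.
(* Majorant from |f + g|^2 <= 2 |f|^2 + 2 |g|^2. *)
have iG := integrableD mD (integrableZl mD 2 f2) (integrableZl mD 2 g2).
apply: (le_integrable mD _ _ iG).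
  by apply/measurable_EFinP; exact: (normc_sqr_measurable (cmeasurableD mf mg)).
move=> t _; rewrite /= -?EFinM -?EFinD lee_fin.
rewrite [leLHS]ger0_norm ?sqr_ge0// (le_trans _ (ler_norm _))//.
have n1 := le_normcD (f t) (g t).
have n2 := normc_ge0 (f t); have n3 := normc_ge0 (g t).
have n4 := normc_ge0 (f t + g t); have n5 := sqr_ge0 (normc (f t) - normc (g t)).
nra.
Qed.

Lemma sqr_integrableZ a f : sqr_integrable f -> sqr_integrable (fun t => a * f t).
Proof.
move=> [mf f2]; split.
  by apply: cmeasurableM => //; exact: cmeasurable_cst.
have := integrableZl mD (normc a ^+ 2) f2.
by congr integrable; apply/funext => t /=; rewrite -EFinM normcM exprMn.
Qed.

Lemma sqr_integrableB f g : sqr_integrable f -> sqr_integrable g ->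
  sqr_integrable (fun t => f t - g t).
Proof.
move=> sf sg; have := sqr_integrableD sf (sqr_integrableZ (-1) sg).
by congr sqr_integrable; apply/funext => t; rewrite mulN1r.
Qed.

End complex_integral.

(** * The inner product for a weight bounded above and below *)

Section weighted_inner_product.
Context {R : realType}.
Notation mu := (@lebesgue_measure R).
Variables (D : set (measurableTypeR R)) (W : R -> R) (m M : R).
Hypothesis mD : measurable D.
Hypothesis mW : measurable_fun D W.
Hypothesis m_gt0 : 0 < m.
Hypothesis W_bounds : forall t, D t -> m <= W t <= M.
Implicit Types (f g h : R -> R[i]).

(** Conjugate-linear in the second argument; [energy] is the associated quadratic form, taken as a
    real number. *)
Definition inner f g : R[i] :=
  cintegral mu D (fun t => f t * conjc (g t) * (W t)%:C).

Definition energy f : R := \int[mu]_(t in D) (normc (f t) ^+ 2 * W t).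

Let cmW : cmeasurable D (fun t => (W t)%:C).
Proof. by split=> //; exact: measurable_cst. Qed.

Lemma inner_integrable f g : sqr_integrable D f -> sqr_integrable D g ->
  cintegrable D (fun t => f t * conjc (g t) * (W t)%:C).
Proof.
move=> [mf f2] [mg g2]; have mgc := cmeasurable_conj mg.
(* Majorant from |f g| W <= M (|f|^2 + |g|^2). *)
have iG := integrableD mD (integrableZl mD M f2) (integrableZl mD M g2).
apply: (le_cintegrable mD (G := fun t => M * normc (f t) ^+ 2 + M * normc (g t) ^+ 2)).
- by apply: cmeasurableM => //; exact: cmeasurableM.
- exact: iG.
- move=> t Dt; have /andP[mWt WM] := W_bounds Dt.
  have W0 : 0 < W t by exact: lt_le_trans mWt.
  rewrite !normcM normc_conj normc_real gtr0_norm//.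
  have n2 := normc_ge0 (f t); have n3 := normc_ge0 (g t).
  have n5 := sqr_ge0 (normc (f t) - normc (g t)).
  rewrite -mulrDr mulrC; apply: ler_pM => //; [exact: ltW|exact: mulr_ge0|].
  nra.
Qed.

Lemma innerDl f g h : sqr_integrable D f -> sqr_integrable D g ->
  sqr_integrable D h ->
  inner (fun t => f t + g t) h = inner f h + inner g h.
Proof.
move=> sf sg sh; rewrite /inner -(cintegralD mD); [|exact: inner_integrable..].
by apply: eq_cintegral => t _; rewrite !mulrDl.
Qed.

Lemma innerZl a f h : sqr_integrable D f -> sqr_integrable D h ->
  inner (fun t => a * f t) h = a * inner f h.
Proof.
move=> sf sh; rewrite /inner -(cintegralZ mD); last exact: inner_integrable.
by apply: eq_cintegral => t _; rewrite !mulrA.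
Qed.

Lemma innerDr f g h : sqr_integrable D f -> sqr_integrable D g ->
  sqr_integrable D h ->
  inner h (fun t => f t + g t) = inner h f + inner h g.
Proof.
move=> sf sg sh; rewrite /inner -(cintegralD mD); [|exact: inner_integrable..].
by apply: eq_cintegral => t _; rewrite rmorphD mulrDr mulrDl.
Qed.

Lemma innerZr a f h : sqr_integrable D f -> sqr_integrable D h ->
  inner h (fun t => a * f t) = conjc a * inner h f.
Proof.
move=> sf sh; rewrite /inner -(cintegralZ mD); last exact: inner_integrable.
by apply: eq_cintegral => t _; rewrite rmorphM -!mulrA mulrCA.
Qed.

Lemma energy_integrable f : sqr_integrable D f ->
  mu.-integrable D (EFin \o (fun t => normc (f t) ^+ 2 * W t)).
Proof.
move=> [mf f2]; apply: (le_integrable mD _ _ (integrableZl mD M f2)).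
  by apply/measurable_EFinP; apply: measurable_funM => //; exact: normc_sqr_measurable.
move=> t Dt; have /andP[mWt WM] := W_bounds Dt.
have W0 : 0 < W t by exact: lt_le_trans mWt.
have fW0 : 0 <= normc (f t) ^+ 2 * W t by rewrite mulr_ge0 ?sqr_ge0// ltW.
rewrite /= -?EFinM lee_fin [leLHS]ger0_norm//.
by rewrite (le_trans _ (ler_norm _))// mulrC ler_wpM2r// sqr_ge0.
Qed.

(** Together with [energy_le], this lets orthogonality for the weight serve convergence in the
    unweighted norm. *)
Lemma energy_ge f : sqr_integrable D f ->
  m * \int[mu]_(t in D) (normc (f t) ^+ 2) <= energy f.
Proof.
move=> sf; have [mf f2] := sf; rewrite -RintegralZl//.
apply: (le_Rintegral mD (integrableZl mD m f2) (energy_integrable sf)).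
move=> t Dt; have /andP[mWt WM] := W_bounds Dt.
by rewrite mulrC ler_wpM2l// sqr_ge0.
Qed.

Lemma energy_le f : sqr_integrable D f ->
  energy f <= M * \int[mu]_(t in D) (normc (f t) ^+ 2).
Proof.
move=> sf; have [mf f2] := sf; rewrite -RintegralZl//.
apply: (le_Rintegral mD (energy_integrable sf) (integrableZl mD M f2)).
move=> t Dt; have /andP[mWt WM] := W_bounds Dt.
by rewrite mulrC ler_wpM2r// sqr_ge0.
Qed.

Lemma energy_ge0 f : 0 <= energy f.
Proof.
apply: Rintegral_ge0 => t Dt; have /andP[mWt _] := W_bounds Dt.
by rewrite mulr_ge0 ?sqr_ge0// (le_trans (ltW m_gt0)).
Qed.

Lemma energyZ a f : sqr_integrable D f ->
  energy (fun t => a * f t) = normc a ^+ 2 * energy f.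
Proof.
move=> sf; rewrite /energy -RintegralZl//; last exact: energy_integrable.
by apply: eq_Rintegral => t _; rewrite normcM exprMn -!mulrA.
Qed.

(** Pythagoras: the cross term of |f + g|^2 W is twice the real part of the integrand of
    [inner f g]. *)
Lemma energyD f g : sqr_integrable D f -> sqr_integrable D g ->
  inner f g = 0 -> energy (fun t => f t + g t) = energy f + energy g.
Proof.
move=> sf sg fg0; have [iRe _] := inner_integrable sf sg.
have ife := energy_integrable sf; have ige := energy_integrable sg.
have Re0 : \int[mu]_(t in D) complex.Re (f t * conjc (g t) * (W t)%:C) = 0.
  by case: fg0.
transitivity (\int[mu]_(t in D) ((normc (f t) ^+ 2 * W t + normc (g t) ^+ 2 * W t)
    + 2 * complex.Re (f t * conjc (g t) * (W t)%:C))).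
  apply: eq_Rintegral => t _; rewrite !normc_sqr.
  by case: (f t) (g t) => [a b] [a' b'] /=; ring.
rewrite (RintegralD mD (integrableD mD ife ige) (integrableZl mD 2 iRe)).
by rewrite RintegralD// RintegralZl// Re0 mulr0 addr0.
Qed.

End weighted_inner_product.

(** * A monotone phase and the orthonormality of its modes *)

Section phase.
Context {R : realType}.
Notation mu := (@lebesgue_measure R).
Variables (theta dtheta : R -> R) (T sg m M : R).
Notation D := (`]0, T[%classic : set (measurableTypeR R)).
Hypothesis T_gt0 : 0 < T.
Hypothesis sg2 : sg ^+ 2 = 1.
Hypothesis dtheta_continuous : continuous dtheta.
Hypothesis theta_LR : derivable_oo_LRcontinuous theta 0 T.
Hypothesis theta_derive : forall t : R, 0 < t < T -> derive1 theta t = dtheta t.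
Hypothesis theta_at0 : theta 0 = 0.
Hypothesis theta_atT : theta T = sg * (2 * pi).
Hypothesis m_gt0 : 0 < m.
Hypothesis dtheta_bounds : forall t : R, 0 < t < T -> m <= sg * dtheta t <= M.

Let mD : measurable D. Proof. exact: measurable_itv. Qed.

Let is_derive_theta t : 0 < t < T -> is_derive t 1 theta (dtheta t).
Proof.
move=> t0T; have [dth _ _] := theta_LR.
by apply: DeriveDef; [apply: dth; rewrite in_itv|rewrite -derive1E theta_derive].
Qed.

Lemma phase_measurable : measurable_fun D theta.
Proof.
apply: open_continuous_measurable_fun; first exact: interval_open.
move=> t; rewrite inE/= => t0T; have [dth _ _] := theta_LR.
by apply/differentiable_continuous/derivable1_diffP; exact: dth.
Qed.

(** The derivative is positive inside; continuity at the endpoints includes 0 and T, which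
    [phase_range] compares with. *)
Lemma phase_incr s t : 0 <= s -> s < t -> t <= T -> sg * theta s < sg * theta t.
Proof.
move=> s0 st tT.
have dsg (x : R) : 0 < x < T -> is_derive x 1 (fun x => sg * theta x) (sg * dtheta x).
  by move=> x0T; have := is_derive_theta x0T => ?; exact: is_deriveZ.
apply: (@gtr0_derive1_incr R (fun t => sg * theta t) 0 T) => //.
- by move=> x; rewrite in_itv/= => /dsg[].
- move=> x; rewrite in_itv/= => x0T; rewrite derive1E.
  have [_ ->] := dsg _ x0T; have /andP[+ _] := dtheta_bounds x0T.
  exact: lt_le_trans.
- apply/subspace_continuousP => x Dx; apply: cvgMl_tmp.
  by have /subspace_continuousP := derivable_oo_LRcontinuous_within theta_LR; exact.
Qed.

Lemma phase_range t : 0 < t < T -> 0 < sg * theta t < 2 * pi.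
Proof.
move=> /andP[t0 tT]; apply/andP; split.
  by rewrite -(mulr0 sg) -theta_at0 phase_incr// ltW.
have -> : 2 * pi = sg * theta T by rewrite theta_atT mulrA -expr2 sg2 mul1r.
by rewrite phase_incr// ltW.
Qed.

(** Fundamental theorem of calculus: the integrand is the derivative of t |-> Phi (l * theta t). *)
Lemma integral_phase (Phi phi : R -> R) (l : R) :
  (forall x : R, is_derive x 1 Phi (phi x)) -> continuous phi ->
  \int[mu]_(t in D) (phi (l * theta t) * (l * dtheta t)) =
  Phi (l * theta T) - Phi (l * theta 0).
Proof.
move=> dPhi cphi.
have [_ LR0 LRT] := theta_LR.
have cPhi : continuous Phi.
  move=> x; apply/differentiable_continuous/derivable1_diffP.
  by have [] := dPhi x.
pose f t := phi (l * theta t) * (l * dtheta t).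
have cf : {within `[0, T], continuous f}.
  apply/subspace_continuousP => x Dx; apply: cvgM.
    apply: (@continuous_cvg _ _ _ _ _ (fun t => l * theta t) phi); first exact: cphi.
    apply: cvgMl_tmp.
    by have /subspace_continuousP := derivable_oo_LRcontinuous_within theta_LR; exact.
  by apply: cvgMl_tmp; apply: cvg_within_filter; exact: dtheta_continuous.
have itf : mu.-integrable `[0, T] (EFin \o f).
  exact: continuous_compact_integrable (@segment_compact _ _ _) cf.
rewrite -/f.
(* The fundamental theorem concerns [0, T]; adding the two endpoints does not change the
   integral. *)
have i1 : mu.-integrable `]0, T[ (EFin \o f).
  by apply: integrableS itf => //; exact: subset_itv_oo_cc.
have i2 : mu.-integrable `]0, T] (EFin \o f).
  by apply: integrableS itf => //; exact: subset_itv_oc_cc.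
rewrite (Rintegral_itv_bndo_bndc i1) (Rintegral_itv_obnd_cbnd i2).
have dF (x : R) : 0 < x < T -> is_derive x 1 (fun t => Phi (l * theta t)) (f x).
  move=> x0T; have dth := is_derive_theta x0T.
  have dl : is_derive x 1 (fun t => l * theta t) (l * dtheta x) by exact: is_deriveZ.
  exact: (@is_derive1_comp R Phi (fun t => l * theta t) x _ _ (dPhi _) dl).
rewrite /Rintegral (@continuous_FTC2 R f (fun t => Phi (l * theta t)) 0 T)//.
- split.
  + by move=> x; rewrite in_itv/= => /dF[].
  + by apply: continuous_cvg; [exact: cPhi|exact: cvgMl_tmp].
  + by apply: continuous_cvg; [exact: cPhi|exact: cvgMl_tmp].
- by move=> x; rewrite in_itv/= => x0T; rewrite derive1E; have [_ ->] := dF _ x0T.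
Qed.

(* Total mass 1, since sg * theta increases by 2 pi on [0, T]. *)
Definition weight (t : R) := (2 * pi)^-1 * (sg * dtheta t).

(** The integrand is e^{i l theta} times the weight, with l = n - k. For l != 0 it is an exact
    derivative and l * theta runs from 0 to a multiple of 2 pi; for l = 0 the total mass of the
    weight remains. *)
Lemma mode_orthonormal n k :
  inner D weight (mode theta n) (mode theta k) = (n == k)%:R.
Proof.
have pi2 : 2 * pi != 0 :> R by rewrite mulf_neq0// gt_eqF// pi_gt0.
set l : R := (n - k)%:~R.
have E t : mode theta n t * conjc (mode theta k t) * (weight t)%:C =
    (cos (l * theta t) * weight t) +i* (sin (l * theta t) * weight t).
  by rewrite mode_conj -modeD /mode /expi; simpc.
rewrite /inner (eq_cintegral (fun t _ => E t)) /cintegral /=.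
have ex : expi (l * theta T) = 1.
  have : sg ^+ 2 == 1 ^+ 2 by rewrite sg2 expr1n.
  rewrite eqf_sqr theta_atT mulrA => /orP[/eqP->|/eqP->].
    by rewrite mulr1 expi_2pi_int.
  by rewrite mulrN1 mulNr -expi_conj expi_2pi_int conjc1.
have [cosT sinT] : cos (l * theta T) = 1 /\ sin (l * theta T) = 0.
  by case: ex.
have [nk|nk] := eqVneq n k.
  (* Here [integral_phase] is used with factor 1 and a linear primitive, as the factor l = 0 would
     erase [dtheta]. *)
  have -> : l = 0 by rewrite /l nk subrr.
  pose a := (2 * pi)^-1 * sg.
  have da (x : R) : is_derive x 1 (fun x : R => a * x) (cst a x).
    by rewrite /cst -[X in is_derive _ _ _ X]mulr1; exact: is_deriveZ.
  have ca : continuous (cst a : R -> R) by move=> x; exact: cvg_cst.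
  have d0 (x : R) : is_derive x 1 (cst 0 : R -> R) (cst 0 x) by exact: is_derive_cst.
  have c0 : continuous (cst 0 : R -> R) by move=> x; exact: cvg_cst.
  congr (_ +i* _).
    transitivity (\int[mu]_(t in D) (cst a (1 * theta t) * (1 * dtheta t))).
      by apply: eq_Rintegral => t _; rewrite mul0r cos0 !mul1r /weight mulrA.
    rewrite (integral_phase _ da ca) theta_at0 theta_atT !mulr0 subr0 mul1r.
    by rewrite /a -mulrA (mulrA sg sg) -expr2 sg2 mul1r mulVf.
  transitivity (\int[mu]_(t in D) (cst 0 (1 * theta t) * (1 * dtheta t))).
    by apply: eq_Rintegral => t _; rewrite mul0r sin0 !mul0r.
  by rewrite (integral_phase _ d0 c0) subrr.
have l0 : l != 0 by rewrite intr_eq0 subr_eq0.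
(* Dividing by l compensates the factor l that the chain rule produces. *)
pose a := (2 * pi)^-1 * sg / l.
have Wa t : weight t = a * (l * dtheta t).
  by rewrite /weight /a -!mulrA mulKf.
have ds (x : R) : is_derive x 1 (fun x : R => a * sin x) (a * cos x).
  exact: is_deriveZ.
have cc : continuous (fun x : R => a * cos x).
  by move=> x; apply: cvgMl_tmp; exact: continuous_cos.
have dc (x : R) : is_derive x 1 (fun x : R => - a * cos x) (a * sin x).
  by rewrite -[X in is_derive _ _ _ X]mulrNN; exact: is_deriveZ.
have cs : continuous (fun x : R => a * sin x).
  by move=> x; apply: cvgMl_tmp; exact: continuous_sin.
congr (_ +i* _).
  transitivity (\int[mu]_(t in D) ((a * cos (l * theta t)) * (l * dtheta t))).
    by apply: eq_Rintegral => t _; rewrite Wa mulrCA mulrA.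
  by rewrite (integral_phase _ ds cc) sinT theta_at0 !mulr0 sin0 mulr0 subrr.
transitivity (\int[mu]_(t in D) ((a * sin (l * theta t)) * (l * dtheta t))).
  by apply: eq_Rintegral => t _; rewrite Wa mulrCA mulrA.
by rewrite (integral_phase _ dc cs) cosT theta_at0 mulr0 cos0 subrr.
Qed.

End phase.

(** * Fourier expansion in a family orthonormal for the weight *)

Section orthonormal_expansion.
Context {R : realType}.
Notation mu := (@lebesgue_measure R).
Variables (D : set (measurableTypeR R)) (W : R -> R) (m M : R) (theta : R -> R).
Hypothesis mD : measurable D.
Hypothesis mW : measurable_fun D W.
Hypothesis m_gt0 : 0 < m.
Hypothesis M_gt0 : 0 < M.
Hypothesis W_bounds : forall t, D t -> m <= W t <= M.
Notation e := (mode theta).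
Hypothesis mode_sqr : forall n, sqr_integrable D (e n).
Hypothesis orthonormal : forall n k, inner D W (e n) (e k) = (n == k)%:R.
Implicit Types (f g h : R -> R[i]) (a b : int -> R[i]).

Let innerDlW := innerDl mD mW m_gt0 W_bounds.
Let innerDrW := innerDr mD mW m_gt0 W_bounds.
Let innerZlW := innerZl mD mW m_gt0 W_bounds.
Let innerZrW := innerZr mD mW m_gt0 W_bounds.

Definition sqnorm f : R := \int[mu]_(t in D) (normc (f t) ^+ 2).

Lemma trig_poly_sqr_integrable p : trig_poly theta p -> sqr_integrable D p.
Proof.
elim=> [n|f g _ sf _ sg|a f _ sf]; first exact: mode_sqr.
- exact: sqr_integrableD.
- exact: sqr_integrableZ.
Qed.

Lemma trig_poly0 : trig_poly theta (fun=> 0).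
Proof.
apply: (eq_trig_poly _ (trig_polyZ 0 (trig_poly_mode theta 0))) => t.
by rewrite mul0r.
Qed.

Lemma trig_poly_sum (s : seq int) a :
  trig_poly theta (fun t => \sum_(n <- s) a n * e n t).
Proof.
elim: s => [|n s IH].
  by apply: (eq_trig_poly _ trig_poly0) => t; rewrite big_nil.
apply: (eq_trig_poly _ (trig_polyD (trig_polyZ (a n) (trig_poly_mode theta n)) IH)).
by move=> t; rewrite big_cons.
Qed.

(** The integers from -N to N, in the order of [sym_partial_sum]; sums over a list are open to
    induction. *)
Definition sym_range (N : nat) : seq int :=
  [seq k%:Z - N%:Z | k <- index_iota 0 (2 * N).+1].

Lemma sym_partial_sumE a (d : int -> R -> R[i]) N t :
  sym_partial_sum a d N t = \sum_(n <- sym_range N) a n * d n t.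
Proof. by rewrite big_map big_mkord. Qed.

Lemma mem_sym_range N n : (`|n| <= N)%N -> n \in sym_range N.
Proof.
move=> nN; apply/mapP; exists (absz (n + N%:Z)); last by lia.
by rewrite mem_index_iota; lia.
Qed.

Lemma sym_range_le N n : n \in sym_range N -> (`|n| <= N)%N.
Proof. by case/mapP => k; rewrite mem_index_iota => ? ->; lia. Qed.

Lemma uniq_sym_range N : uniq (sym_range N).
Proof. by rewrite map_inj_uniq ?iota_uniq// => i j; lia. Qed.

Lemma inner_trig_sum (s : seq int) a n : uniq s ->
  inner D W (fun t => \sum_(k <- s) a k * e k t) (e n) =
  if n \in s then a n else 0.
Proof.
elim: s => [_|k s IH /= /andP[ks us]].
  (* The empty sum is written as 0 times a mode, so that homogeneity yields 0. *)
  rewrite (_ : (fun=> _) = (fun t => 0 * e 0 t)).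
    by rewrite innerZlW// mul0r.
  by apply/funext => t; rewrite big_nil mul0r.
rewrite (_ : (fun=> _) = (fun t => a k * e k t + \sum_(k <- s) a k * e k t)).
  rewrite innerDlW//; last 2 first.
  - exact: sqr_integrableZ.
  - exact/trig_poly_sqr_integrable/trig_poly_sum.
  rewrite innerZlW// orthonormal IH// in_cons eq_sym.
  have [->|nk] := eqVneq n k; first by rewrite (negbTE ks) mulr1 addr0.
  by rewrite mulr0 add0r.
by apply/funext => t; rewrite big_cons.
Qed.

Lemma inner_trig_sum_eq0 (s : seq int) a g : sqr_integrable D g ->
  {in s, forall n, inner D W g (e n) = 0} ->
  inner D W g (fun t => \sum_(k <- s) a k * e k t) = 0.
Proof.
move=> sg; elim: s => [_|k s IH gs].
  rewrite (_ : (fun=> _) = (fun t => 0 * e 0 t)).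
    by rewrite innerZrW// conjc0 mul0r.
  by apply/funext => t; rewrite big_nil mul0r.
rewrite (_ : (fun=> _) = (fun t => a k * e k t + \sum_(k <- s) a k * e k t)).
  have sS := trig_poly_sqr_integrable (trig_poly_sum s a).
  rewrite (innerDrW (sqr_integrableZ mD (a k) (mode_sqr k)) sS sg).
  rewrite innerZrW// gs ?mem_head// mulr0 add0r IH// => n ns.
  by rewrite gs// in_cons ns orbT.
by apply/funext => t; rewrite big_cons.
Qed.

(** A trigonometric polynomial involves finitely many modes; [N0] stands in for its degree and is
    independent of g. *)
Lemma inner_trig_poly_eq0 p : trig_poly theta p -> exists N0 : nat,
  forall N, (N0 <= N)%N -> forall g, sqr_integrable D g ->
    (forall n, (`|n| <= N)%N -> inner D W g (e n) = 0) -> inner D W g p = 0.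
Proof.
elim=> [n|f1 f2 t1 [N1 h1] t2 [N2 h2]|a f t1 [N1 h1]].
- by exists `|n|%N => N nN g _; exact.
- exists (maxn N1 N2) => N; rewrite geq_max => /andP[N1N N2N] g sg g0.
  rewrite innerDrW ?(h1 N) ?(h2 N) ?addr0//;
    exact: trig_poly_sqr_integrable.
- exists N1 => N N1N g sg g0.
  rewrite innerZrW ?(h1 N) ?mulr0//.
  exact: trig_poly_sqr_integrable.
Qed.

Definition fourier_coef f (n : int) := inner D W f (e n).

Lemma sym_partial_sum_trig a N : trig_poly theta (sym_partial_sum a e N).
Proof.
apply: (eq_trig_poly _ (trig_poly_sum (sym_range N) a)) => t.
by rewrite sym_partial_sumE.
Qed.

Lemma inner_sym_partial_sum a N n : (`|n| <= N)%N ->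
  inner D W (sym_partial_sum a e N) (e n) = a n.
Proof.
move=> nN; rewrite (_ : sym_partial_sum a e N =
    (fun t => \sum_(n <- sym_range N) a n * e n t)).
  by rewrite inner_trig_sum ?uniq_sym_range// mem_sym_range.
by apply/funext => t; rewrite sym_partial_sumE.
Qed.

Lemma inner_residue f a N n : sqr_integrable D f -> (`|n| <= N)%N ->
  inner D W (fun t => f t - sym_partial_sum a e N t) (e n) =
  fourier_coef f n - a n.
Proof.
move=> sf nN; have sS := trig_poly_sqr_integrable (sym_partial_sum_trig a N).
rewrite (_ : (fun=> _) = (fun t => f t + (-1) * sym_partial_sum a e N t)).
  rewrite innerDlW//; last exact: sqr_integrableZ.
  by rewrite innerZlW// inner_sym_partial_sum// mulN1r.
by apply/funext => t; rewrite mulN1r.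
Qed.

(** For N >= N0 the residue f - S is orthogonal to both S and p. By Pythagoras on f - p = (f - S) +
    (S - p), its energy is at most that of f - p; m and M convert energies to plain norms. *)
Lemma best_approximation f p : sqr_integrable D f -> trig_poly theta p ->
  exists N0 : nat, forall N, (N0 <= N)%N ->
    m * sqnorm (fun t => f t - sym_partial_sum (fourier_coef f) e N t) <=
    M * sqnorm (fun t => f t - p t).
Proof.
move=> sf tp; have [N0 pN0] := inner_trig_poly_eq0 tp; exists N0 => N N0N.
set S := sym_partial_sum (fourier_coef f) e N.
have tS : trig_poly theta S by exact: sym_partial_sum_trig.
have sS := trig_poly_sqr_integrable tS; have sp := trig_poly_sqr_integrable tp.
have sfS := sqr_integrableB mD sf sS; have sfp := sqr_integrableB mD sf sp.
have sSp := sqr_integrableB mD sS sp.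
have perp n : (`|n| <= N)%N -> inner D W (fun t => f t - S t) (e n) = 0.
  by move=> nN; rewrite inner_residue// subrr.
apply: le_trans (energy_ge mD mW m_gt0 W_bounds sfS) _.
apply: le_trans _ (energy_le mD mW m_gt0 W_bounds sfp).
have fS0 : inner D W (fun t => f t - S t) S = 0.
  rewrite [X in inner D W _ X](_ : S =
      (fun t => \sum_(n <- sym_range N) fourier_coef f n * e n t)).
    by apply: inner_trig_sum_eq0 => // n /sym_range_le; exact: perp.
  by apply/funext => t; rewrite -sym_partial_sumE.
have fp0 : inner D W (fun t => f t - S t) p = 0 by exact: (pN0 N).
have fSp : inner D W (fun t => f t - S t) (fun t => S t - p t) = 0.
  rewrite (_ : (fun t => S t - p t) = (fun t => S t + (-1) * p t)).
    rewrite (innerDrW sS (sqr_integrableZ mD (-1) sp) sfS) innerZrW//.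
    by rewrite fS0 fp0 mulr0 addr0.
  by apply/funext => t; rewrite mulN1r.
rewrite (_ : (fun t => f t - p t) = (fun t => (f t - S t) + (S t - p t))).
  rewrite (energyD mD mW m_gt0 W_bounds sfS sSp fSp).
  by rewrite lerDl (energy_ge0 m_gt0 W_bounds).
by apply/funext => t; rewrite subrKA.
Qed.

(** Bessel's inequality for one mode: f splits orthogonally into [d * e n] and the rest, and a mode
    has energy 1. *)
Lemma fourier_coef_sqr_le f n : sqr_integrable D f ->
  normc (fourier_coef f n) ^+ 2 <= M * sqnorm f.
Proof.
move=> sf; set d := fourier_coef f n.
have sd := sqr_integrableZ mD d (mode_sqr n).
have sh := sqr_integrableB mD sf sd.
have h0 : inner D W (fun t => f t - d * e n t) (e n) = 0.
  rewrite (_ : (fun=> _) = (fun t => f t + (-1) * (d * e n t))).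
    rewrite (innerDlW sf (sqr_integrableZ mD (-1) sd) (mode_sqr n)).
    by rewrite !innerZlW// orthonormal eqxx mulr1 mulN1r subrr.
  by apply/funext => t; rewrite mulN1r.
have hd : inner D W (fun t => f t - d * e n t) (fun t => d * e n t) = 0.
  by rewrite innerZrW// h0 mulr0.
have en1 : energy D W (e n) = 1.
  have := orthonormal n n; rewrite eqxx /inner /cintegral => -[<- _].
  apply: eq_Rintegral => t _; rewrite normc_sqr.
  by rewrite /mode /expi /=; ring.
apply: le_trans (energy_le mD mW m_gt0 W_bounds sf).
rewrite [X in energy D W X](_ : f =
    (fun t => (f t - d * e n t) + d * e n t)); last first.
  by apply/funext => t; rewrite subrK.
rewrite (energyD mD mW m_gt0 W_bounds sh sd hd) (energyZ mD mW m_gt0 W_bounds)//.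
by rewrite en1 mulr1 lerDr (energy_ge0 m_gt0 W_bounds).
Qed.

Hypothesis trig_dense : forall f, sqr_integrable D f -> forall eps : R, 0 < eps ->
  exists2 p, trig_poly theta p & sqnorm (fun t => f t - p t) < eps.

Lemma fourier_series_cvg f : sqr_integrable D f ->
  sqnorm (fun t => f t - sym_partial_sum (fourier_coef f) e N t) @[N --> \oo] --> 0.
Proof.
move=> sf; apply/cvgrPdist_lt => eps eps0.
(* The factor m / M offsets the two constants of [best_approximation]. *)
have e0 : 0 < eps * m / M by rewrite divr_gt0// mulr_gt0.
have [p tp fp] := trig_dense sf e0.
have [N0 H] := best_approximation sf tp.
near=> N; rewrite sub0r normrN ger0_norm; last first.
  by apply: Rintegral_ge0 => t _; rewrite sqr_ge0.
rewrite -(ltr_pM2l m_gt0); apply: (le_lt_trans (H N _)).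
  by near: N; exact: nbhs_infty_ge.
by move: fp; rewrite ltr_pdivlMr// mulrC (mulrC eps).
Unshelve. all: by end_near. Qed.

(** For N >= |n| the n-th coefficient of the residue is [fourier_coef f n - a n], whatever N is;
    Bessel bounds it by the norm of the residue, which tends to 0. *)
Lemma fourier_coef_unique f a : sqr_integrable D f ->
  sqnorm (fun t => f t - sym_partial_sum a e N t) @[N --> \oo] --> 0 ->
  a = fourier_coef f.
Proof.
move=> sf cv; apply/funext => n; apply/esym/eqP; rewrite -subr_eq0.
apply/eqP/eq0_normc/eqP; rewrite -sqrf_eq0 eq_le sqr_ge0 andbT.
apply/ler_addgt0Pr => eps eps0; rewrite add0r.
have e0 : 0 < eps / M by rewrite divr_gt0.
have [N nN small] : exists2 N, (`|n| <= N)%N &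
    sqnorm (fun t => f t - sym_partial_sum a e N t) < eps / M.
  have /cvgrPdist_lt /(_ _ e0) [N0 _ H] := cv.
  exists (maxn `|n| N0); first exact: leq_maxl.
  have := H (maxn `|n| N0) (leq_maxr _ _).
  by rewrite /= sub0r normrN; apply: le_lt_trans; exact: ler_norm.
rewrite -(inner_residue a sf nN).
have sS := trig_poly_sqr_integrable (sym_partial_sum_trig a N).
apply: le_trans (fourier_coef_sqr_le n (sqr_integrableB mD sf sS)) _.
by rewrite mulrC -ler_pdivlMr// ltW.
Qed.

End orthonormal_expansion.

(** * The norm of L^2(0, T) as a square root *)

Section L2_norm.
Context {R : realType}.
Notation mu := (@lebesgue_measure R).
Variable T : R.
Notation D := (`]0, T[%classic : set (measurableTypeR R)).
Implicit Types (f : R -> R[i]).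

Let mD : measurable D. Proof. exact: measurable_itv. Qed.

Lemma L2normE f :
  L2norm T f = ((\int[mu]_(t in D) (normc (f t) ^+ 2)%:E) `^ 2^-1)%E.
Proof.
rewrite /L2norm unlock; congr (_ `^ _)%E.
rewrite [RHS]integral_mkcond; apply: eq_integral => t _.
rewrite !patchE; case: ifP => _ /=; last by rewrite normr0 powR0.
by rewrite ger0_norm ?normc_ge0// powR_mulrn ?normc_ge0.
Qed.

Lemma sqr_integrable_fin f : sqr_integrable D f ->
  (\int[mu]_(t in D) (normc (f t) ^+ 2)%:E = (sqnorm D f)%:E)%E.
Proof.
move=> [mf f2]; rewrite /sqnorm /Rintegral fineK//.
exact: integrable_fin_num.
Qed.

Lemma sqnorm_ge0 f : 0 <= sqnorm D f.
Proof. by apply: Rintegral_ge0 => t _; rewrite sqr_ge0. Qed.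

Lemma L2norm_sqr_integrable f : sqr_integrable D f ->
  L2norm T f = (Num.sqrt (sqnorm D f))%:E.
Proof.
move=> sf; rewrite L2normE sqr_integrable_fin// poweR_EFin.
by rewrite powR12_sqrt// sqnorm_ge0.
Qed.

Lemma in_L2P f : in_L2 T f <-> sqr_integrable D f.
Proof.
split=> [[m1 m2 fL2]|sf]; last first.
  by have [[m1 m2] _] := sf; split=> //; rewrite L2norm_sqr_integrable// ltry.
have mf : cmeasurable D f by [].
split=> //; apply/integrableP; split.
  by apply/measurable_EFinP; exact: normc_sqr_measurable.
rewrite (_ : integral _ _ _ = (\int[mu]_(t in D) (normc (f t) ^+ 2)%:E)%E); last first.
  by apply: eq_integral => t _; rewrite /= ger0_norm// sqr_ge0.
(* An infinite integral would have an infinite power 1 / 2, that is, an infinite norm. *)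
rewrite ltNge leye_eq; apply/eqP => foo; move: fL2.
by rewrite L2normE foo poweRyr ?invr_eq0 ?ltxx.
Qed.

(** Squaring gives one direction, continuity of the square root the other. *)
Lemma L2norm_cvg0 (f_ : nat -> R -> R[i]) :
  (forall n, sqr_integrable D (f_ n)) ->
  L2norm T (f_ n) @[n --> \oo] --> 0%E <-> sqnorm D (f_ n) @[n --> \oo] --> 0.
Proof.
move=> sf; have -> : (fun n => L2norm T (f_ n)) =
    (fun n => (Num.sqrt (sqnorm D (f_ n)))%:E).
  by apply/funext => n; rewrite L2norm_sqr_integrable.
split=> [H|cv].
  have cv : Num.sqrt (sqnorm D (f_ n)) @[n --> \oo] --> (0 : R).
    by have /fine_cvgP[] := H.
  pose r n := Num.sqrt (sqnorm D (f_ n)).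
  have -> : (fun n => sqnorm D (f_ n)) = r \* r.
    by apply/funext => n; rewrite /r /= -expr2 sqr_sqrtr// sqnorm_ge0.
  by rewrite -(mulr0 (0 : R)); exact: (cvgM cv cv).
apply/fine_cvgP; split; first exact: nearW.
have := @continuous_cvg _ _ _ _ _ _ (@Num.sqrt R) _ (@sqrt_continuous R _) cv => /(_ _).
by rewrite sqrtr0; exact.
Qed.

End L2_norm.

(** * Complete bases of rescaled modes *)

Section phase_basis.
Context {R : realType}.
Notation mu := (@lebesgue_measure R).
Variables (theta dtheta : R -> R) (T sg m M : R).
Notation D := (`]0, T[%classic : set (measurableTypeR R)).
Hypothesis T_gt0 : 0 < T.
Hypothesis sg2 : sg ^+ 2 = 1.
Hypothesis dtheta_continuous : continuous dtheta.
Hypothesis theta_LR : derivable_oo_LRcontinuous theta 0 T.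
Hypothesis theta_derive : forall t : R, 0 < t < T -> derive1 theta t = dtheta t.
Hypothesis theta_at0 : theta 0 = 0.
Hypothesis theta_atT : theta T = sg * (2 * pi).
Hypothesis m_gt0 : 0 < m.
Hypothesis dtheta_bounds : forall t : R, 0 < t < T -> m <= sg * dtheta t <= M.

Lemma phase_complete_basis (c : int -> R[i]) : (forall n, c n != 0) ->
  complete_basis T (fun n t => c n * mode theta n t).
Proof.
move=> c0.
have mD : measurable D by exact: measurable_itv.
have pi2 : 0 < (2 * pi)^-1 :> R by rewrite invr_gt0 mulr_gt0// pi_gt0.
have mtheta := phase_measurable theta_LR.
pose W := weight dtheta sg.
have mW : measurable_fun D W.
  have md : measurable_fun D dtheta.
    by apply: measurable_funTS; exact: continuous_measurable_fun.
  apply: measurable_funM; first exact: measurable_cst.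
  by apply: measurable_funM; first exact: measurable_cst.
have m0 : 0 < (2 * pi)^-1 * m by rewrite mulr_gt0.
(* At the midpoint of (0, T) the bounds on [dtheta] force 0 < m <= M. *)
have Tmid : 0 < T / 2 < T by rewrite divr_gt0//= ltr_pdivrMr// mulr_natr mulr2n ltrDl.
have M_gt0 : 0 < M.
  have /andP[m_le le_M] := dtheta_bounds Tmid.
  by rewrite (lt_le_trans m_gt0)// (le_trans m_le).
have M0 : 0 < (2 * pi)^-1 * M by rewrite mulr_gt0.
have W_bounds t : D t -> (2 * pi)^-1 * m <= W t <= (2 * pi)^-1 * M.
  rewrite /= in_itv/= => /dtheta_bounds/andP[? ?].
  by rewrite /W /weight !ler_wpM2l// ltW.
have mode_sqr n : sqr_integrable D (mode theta n).
  split; first exact: (trig_poly_measurable mtheta (trig_poly_mode theta n)).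
  have mm := trig_poly_measurable mtheta (trig_poly_mode theta n).
  apply: (bounded_integrable_ooitv (normc_sqr_measurable mm)).
  by exists 1 => t; rewrite normc_expi expr1n normr1.
have orth n k := mode_orthonormal T_gt0 sg2 dtheta_continuous theta_LR
  theta_derive theta_at0 theta_atT n k.
have incr s t : 0 < s -> s < t -> t < T -> sg * theta s < sg * theta t.
  move=> s0 st tT.
  by apply: (phase_incr theta_LR theta_derive m_gt0 dtheta_bounds) => //; exact: ltW.
have range (t : R) : 0 < t < T -> 0 < sg * theta t < 2 * pi.
  exact: (phase_range sg2 theta_LR theta_derive theta_at0 theta_atT m_gt0 dtheta_bounds).
have trig_sqr p : trig_poly theta p -> sqr_integrable D p.
  exact: trig_poly_sqr_integrable.
have dense f : sqr_integrable D f -> forall eps : R, 0 < eps ->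
    exists2 p, trig_poly theta p & sqnorm D (fun t => f t - p t) < eps.
  move=> sf eps eps0; have [mf f2] := sf.
  have [p tp fp] := trig_poly_dense mtheta sg2 incr range mf f2 eps0.
  exists p => //; rewrite -lte_fin -sqr_integrable_fin//.
  exact: (sqr_integrableB mD sf (trig_sqr _ tp)).
(* The scalars [c n] move into the coefficients, which reduces the family to the modes. *)
have sumE w N : sym_partial_sum w (fun n t => c n * mode theta n t) N =
    sym_partial_sum (fun n => w n * c n) (mode theta) N.
  by apply/funext => t; apply: eq_bigr => k _; rewrite mulrA.
have sres f a N : sqr_integrable D f ->
    sqr_integrable D (fun t => f t - sym_partial_sum a (mode theta) N t).
  move=> sf; apply: (sqr_integrableB mD sf); apply: trig_sqr.
  exact: sym_partial_sum_trig.
pose w f n := fourier_coef D W theta f n / c n.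
have wc f : (fun n => w f n * c n) = fourier_coef D W theta f.
  by apply/funext => n; rewrite /w divfK.
have expan f : in_L2 T f -> L2_expansion T (fun n t => c n * mode theta n t) f (w f).
  move=> /in_L2P sf; rewrite /L2_expansion.
  under eq_fun do rewrite sumE wc.
  apply/L2norm_cvg0 => [N|]; first exact: sres.
  exact: (fourier_series_cvg mD mW m0 M0 W_bounds).
split.
- by move=> n; apply/in_L2P; exact: sqr_integrableZ.
- move=> f fL2 eps eps0; have sf := (in_L2P T f).1 fL2.
  have cv := expan f fL2.
  have near0 : nbhs (0%E : \bar R) [set y | (y < eps%:E)%E].
    by apply: open_nbhs_nbhs; split; [exact: open_ereal_lt_ereal|rewrite /= lte_fin].
  (* Density follows from the expansion: a partial sum close enough to f is a finite combination. *)
  have [N _ /(_ N (leqnn N)) /= fN] := cv _ near0.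
  exists (sym_range N), (w f); move: fN.
  by congr (L2norm T _ < _)%E; apply/funext => t; rewrite sym_partial_sumE.
- move=> f fL2; exists (w f); split; first exact: expan.
  (* Another expansion w' has coefficients [w' n * c n] on the modes; these are the Fourier
     coefficients, and dividing by [c n] recovers w'. *)
  move=> w'; rewrite /L2_expansion; under eq_fun do rewrite sumE.
  have sf := (in_L2P T f).1 fL2.
  move/L2norm_cvg0 => /(_ (fun N => sres f _ N sf)) cv.
  have wE := fourier_coef_unique mD mW m0 M0 W_bounds mode_sqr orth sf cv.
  by apply/funext => n; rewrite /w -wE mulfK.
Qed.

End phase_basis.

(** * The primitive of the input *)

Section primitive.
Context {R : realType}.
Notation mu := (@lebesgue_measure R).
Variable u : R -> R.
Hypothesis u_continuous : continuous u.

Lemma primitive0_ge0 t : 0 <= t -> primitive0 u t = \int[mu]_(s in `[0, t]) u s.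
Proof.
rewrite /primitive0 le_eqVlt => /predU1P[<-|t0].
  by rewrite set_itv1 Rintegral_set1 subrr.
rewrite [X in _ - X](_ : _ = 0) ?subr0//.
by rewrite set_itv_ge ?Rintegral_set0// bnd_simp -ltNge.
Qed.

Lemma primitive0_0 : primitive0 u 0 = 0.
Proof. by rewrite primitive0_ge0// set_itv1 Rintegral_set1. Qed.

Let u_integrable b : mu.-integrable `[0, b] (EFin \o u).
Proof.
apply: continuous_compact_integrable; first exact: segment_compact.
exact: continuous_subspaceT.
Qed.

Lemma is_derive_primitive0 (t : R) : 0 < t -> is_derive t 1 (primitive0 u) (u t).
Proof.
move=> t0; have t1 : t < t + 1 by rewrite ltrDl.
have [dF F'] := continuous_FTC1_closed t1 (u_integrable _) t0 (@u_continuous t).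
have nearE : \forall s \near t, \int[mu]_(x in `[0, s]) u x = primitive0 u s.
  near=> s; rewrite primitive0_ge0//; near: s.
  by apply: filterS (lt_nbhsr t0) => x /ltW.
apply: near_eq_is_derive nearE _.
rewrite derive1E in F'; exact: DeriveDef.
Unshelve. all: by end_near. Qed.

Lemma primitive0_LR (b : R) : 0 < b -> derivable_oo_LRcontinuous (primitive0 u) 0 b.
Proof.
move=> b0; have := parameterized_integral_continuous (ltW b0) (u_integrable b).
move=> /(continuous_within_itvP _ b0)[_ c0 cb]; split.
- by move=> t; rewrite in_itv/= => /andP[t0 _]; have [] := is_derive_primitive0 t0.
- rewrite primitive0_ge0//; apply: cvg_trans c0; apply: near_eq_cvg.
  by near=> s; rewrite primitive0_ge0.
- rewrite (primitive0_ge0 (ltW b0)); apply: cvg_trans cb; apply: near_eq_cvg.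
  near=> s; rewrite primitive0_ge0//.
  by apply: ltW; near: s; exact: nbhs_left_gt.
Unshelve. all: by end_near. Qed.

(** Mean value theorem on [0, t]: the primitive is t times a value of u. *)
Lemma primitive0_le (B t : R) : (forall s, `|u s| <= B) -> 0 <= t ->
  `|primitive0 u t| <= B * t.
Proof.
move=> uB; rewrite le_eqVlt => /predU1P[<-|t0].
  by rewrite primitive0_0 normr0 mulr0.
have du x : x \in `]0, t[ -> is_derive x 1 (primitive0 u) (u x).
  by rewrite in_itv/= => /andP[x0 _]; exact: is_derive_primitive0.
have [x _] := MVT t0 du (derivable_oo_LRcontinuous_within (primitive0_LR t0)).
rewrite primitive0_0 !subr0 => ->.
by rewrite normrM (gtr0_norm t0) ler_wpM2r// ltW.
Qed.

End primitive.

(** * The period for a small input amplitude *)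

Section driven_basis.
Context {R : realType}.
Variables (u : R -> R) (Omega B : R) (c : int -> R[i]).
Hypothesis u_continuous : continuous u.
Hypothesis u_le : forall t, `|u t| <= B.
Hypothesis Omega_neq0 : Omega != 0.
Hypothesis c_neq0 : forall n, c n != 0.

(** The smallness condition keeps the phase speed at least |Omega| / 2; the error in T is the phase
    perturbation accumulated up to T, divided by |Omega|. *)
Lemma driven_complete_basis (alpha : R) : `|alpha| * B <= `|Omega| / 2 ->
  exists T : R, [/\ 0 < T,
    complete_basis T (driven_order_parameter Omega c alpha u) &
    `|T - 2 * pi / `|Omega| | <= 4 * pi / `|Omega| ^+ 2 * B * `|alpha|].
Proof.
move=> alphaB.
have O0 : 0 < `|Omega| by rewrite normr_gt0.
have pi0 : 0 < pi :> R by exact: pi_gt0.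
pose theta t := Omega * t + alpha * primitive0 u t.
pose dtheta t := Omega + alpha * u t.
pose sg := Num.sg Omega.
have sg2 : sg ^+ 2 = 1 by rewrite sqr_sg Omega_neq0.
have sgO : sg * Omega = `|Omega| by rewrite [RHS]normrEsg.
have sg1 : `|sg| = 1 by rewrite normr_sg Omega_neq0.
have sgM (x : R) : `|sg * alpha * x| = `|alpha| * `|x| by rewrite !normrM sg1 mul1r.
have B0 : 0 <= B by apply: le_trans (u_le 0).
(* A phase of speed at least |Omega| / 2 has covered 2 pi by time b. *)
pose b := 4 * pi / `|Omega|.
have b0 : 0 < b by rewrite divr_gt0// mulr_gt0.
have bO : `|Omega| * b = 4 * pi by rewrite /b mulrC divfK// gt_eqF.
have is_derive_theta (t : R) : 0 < t -> is_derive t 1 theta (dtheta t).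
  move=> t0; have dP := is_derive_primitive0 u_continuous t0.
  have d1 : is_derive t 1 (fun t : R => Omega * t) (Omega * 1) by exact: is_deriveZ.
  have d2 : is_derive t 1 (fun t => alpha * primitive0 u t) (alpha * u t).
    exact: is_deriveZ.
  by rewrite mulr1 in d1; exact: is_deriveD.
have theta_LR (t : R) : 0 < t -> derivable_oo_LRcontinuous theta 0 t.
  move=> t0; have [_ c0 ct] := primitive0_LR u_continuous t0; split.
  - by move=> s; rewrite in_itv/= => /andP[s0 _]; have [] := is_derive_theta _ s0.
  - apply: cvgD; apply: cvgMl_tmp => //.
    by apply: cvg_at_right_filter; exact: cvg_id.
  - apply: cvgD; apply: cvgMl_tmp => //.
    by apply: cvg_at_left_filter; exact: cvg_id.
have theta0 : theta 0 = 0 by rewrite /theta mulr0 primitive0_0 mulr0 addr0.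
have sgtheta t : sg * theta t = `|Omega| * t + sg * alpha * primitive0 u t.
  by rewrite /theta mulrDr !mulrA sgO.
have perturb t : 0 <= t -> `|sg * alpha * primitive0 u t| <= `|alpha| * B * t.
  move=> t0; rewrite sgM -mulrA ler_wpM2l//; exact: primitive0_le.
have [T Tb thetaT] : exists2 T, T \in `[0, b] & sg * theta T = 2 * pi.
  apply: IVT; first exact: ltW.
    apply/subspace_continuousP => x xb; apply: cvgMl_tmp.
    have := derivable_oo_LRcontinuous_within (theta_LR _ b0).
    by move=> /subspace_continuousP; exact.
  rewrite theta0 mulr0 ge_min le_max; apply/andP; split.
    by rewrite mulr_ge0// ltW.
  apply/orP; right; rewrite sgtheta bO.
  have /ler_normlP[+ _] := perturb b (ltW b0).
  (* At time b the unperturbed phase is 4 pi and the perturbation is at most 2 pi in modulus. *)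
  have : `|alpha| * B * b <= `|Omega| / 2 * b by rewrite ler_wpM2r// ltW.
  have -> : `|Omega| / 2 * b = 2 * pi by rewrite mulrAC bO; field.
  lra.
have [T0 Tleb] : 0 < T /\ T <= b.
  move: Tb; rewrite in_itv/= le_eqVlt => /andP[/predU1P[T0|//] _].
  by move: thetaT; rewrite -T0 theta0 mulr0 => /eqP; rewrite lt_eqF// mulr_gt0.
exists T; split => //.
  apply: (@phase_complete_basis _ theta dtheta T sg (`|Omega| / 2) (2 * `|Omega|)) => //.
  - by move=> t; apply: cvgD; [exact: cvg_cst|apply: cvgMl_tmp; exact: u_continuous].
  - exact: theta_LR.
  - by move=> t /andP[t0 _]; rewrite derive1E; have [_ ->] := is_derive_theta _ t0.
  - by rewrite -thetaT mulrA -expr2 sg2 mul1r.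
  - by rewrite divr_gt0.
  - move=> t _; rewrite /dtheta mulrDr sgO mulrA.
    have : `|sg * alpha * u t| <= `|Omega| / 2.
      by rewrite sgM; apply: le_trans alphaB; rewrite ler_wpM2l.
    by move=> /ler_normlP[? ?]; apply/andP; split; lra.
(* Solve 2 pi = |Omega| T + perturbation for T; bounding the perturbation with T <= b then gives the
   constant B b / |Omega|. *)
have -> : T - 2 * pi / `|Omega| = - (sg * alpha * primitive0 u T) / `|Omega|.
  rewrite -thetaT sgtheta; field; exact: lt0r_neq0.
rewrite normrM normrN normfV normr_id ler_pdivrMr//.
apply: le_trans (perturb T (ltW T0)) _.
apply: (@le_trans _ _ (`|alpha| * B * b)).
  by rewrite ler_wpM2l// mulr_ge0.
rewrite le_eqVlt; apply/orP; left; apply/eqP; rewrite /b; field; exact: lt0r_neq0.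
Qed.

End driven_basis.

(* The period as a function of alpha and its first-order estimate *)
Local Close Scope complex_scope.
Unset Implicit Arguments.
Set Strict Implicit.

Theorem corollary4p3 (R : realType) (K Omega : R) (g u : R -> R)
    (rstar : R) (rho : R.-pker (measurableTypeR R) ~> (measurableTypeR R))
    (c : int -> R[i])
    (K_gt0 : 0 < K)
    (g_density : probability_density g)
    (g_mean : has_mean_value g Omega)
    (g_even : even_about Omega g)
    (g_unimodal : unimodal_about Omega g)
    (u_bounded : bounded_fun u)
    (u_continuous : continuous u)
    (rho_steady : steady_state K (fun w => g (w + Omega)) rstar rho)
    (c_def : forall n : int,
       c n = order_parameter (fun w => g (w + Omega)) rho n)
    (c_neq0 : forall n : int, c n != 0)
    (Omega_neq0 : Omega != 0) :
  exists T : R -> R,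
    (\forall alpha \near (0 : R), 0 < T alpha /\
       complete_basis (T alpha) (driven_order_parameter Omega c alpha u)) /\
    (fun alpha : R => T alpha - 2 * pi / `|Omega|) =O_ (0 : R) id.
Proof.
(* The bound is made strictly positive because the threshold on alpha divides by it; [|M| + 1]
   exceeds M, as [bounded_fun] demands. *)
have [B B_gt0 uB] : exists2 B, 0 < B & forall t, `|u t| <= B.
  have [M [_ uM]] := u_bounded; exists (`|M| + 1) => [|t].
    by rewrite ltr_wpDl.
  by apply: uM => //; rewrite (le_lt_trans (ler_norm _))// ltrDl.
have O0 : 0 < `|Omega| by rewrite normr_gt0.
pose k0 := 4 * pi / `|Omega| ^+ 2 * B.
(* The smallness condition sits inside the existential, so that choice yields a function T on all of
   R. *)
have /choice[T HT] : forall alpha : R, exists T : R,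
    `|alpha| * B <= `|Omega| / 2 ->
    [/\ 0 < T, complete_basis T (driven_order_parameter Omega c alpha u) &
      `|T - 2 * pi / `|Omega| | <= k0 * `|alpha|].
  move=> alpha; have [small|_] := boolP (`|alpha| * B <= `|Omega| / 2).
    have [T HT] := driven_complete_basis u_continuous uB Omega_neq0 c_neq0 small.
    by exists T.
  (* Default value outside the small range, where nothing is claimed of T. *)
  by exists 0.
have small : \forall alpha \near (0 : R), `|alpha| * B <= `|Omega| / 2.
  have e0 : 0 < `|Omega| / 2 / B by rewrite divr_gt0// divr_gt0.
  by apply: filterS (@nbhs0_le R R^o _ e0) => alpha; rewrite ler_pdivlMr.
exists T; split.
  by apply: filterS small => alpha /HT[].
(* Every k >= k0 serves as a constant for the big O. *)
apply/eqOP; near=> k; apply: filterS small => alpha /HT[_ _] /le_trans; apply.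
by rewrite ler_wpM2r//; near: k; exact: nbhs_pinfty_ge.
Unshelve. all: by end_near. Qed.
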